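(* Let $\alpha$ be an upper bound on the arboricity of a fully dynamic graph $G$ (at all times), let $\Delta$ bound its maximum degree, and let $\epsilon>0$. If $C\ge(2+\epsilon)\alpha-1$, then there is a deterministic (shift-based) algorithm that maintains a proper $(\Delta+C)$-edge coloring of $G$, processing each insertion in $O(m)$ time (with $m$ the current number of edges) and with worst-case recourse $O(\frac{1}{\epsilon}\log n)$ per insertion. In particular, $C=2\alpha$ (i.e. $\epsilon=\frac1\alpha$) yields $O(\alpha\log n)$ recourse.
   Context: Dynamic edge coloring model: $n$ fixed vertices, a simple graph undergoing edge insertions and deletions, maximum degree always at most $\Delta$; a proper edge coloring with colors from a palette of size $\Delta+C$ must be maintained. The arboricity of a graph is the minimum number of forests into which its edges can be partitioned. Recourse of an update = number of previously colored edges whose color is changed while processing it (coloring the new edge is not counted). *)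

(* Defs.v *)
From mathcomp Require Import all_boot all_order all_algebra.
From mathcomp Require Import reals exp.

Set Implicit Arguments.
Unset Strict Implicit.
Unset Printing Implicit Defensive.

Local Open Scope nat_scope.

(** * Graphs on the vertex set 'I_n, given by their sets of edges
    (an edge being a set of two vertices) *)

Definition edge_set (n : nat) : predArgType := {set {set 'I_n}}.

Definition degree (n : nat) (E : edge_set n) (v : 'I_n) : nat :=
  #|[set e in E | v \in e]|.

Definition adj (n : nat) (E : edge_set n) : rel 'I_n :=
  fun u v => [set u; v] \in E.

(* A cycle visits at least 3 vertices, without repetition, hence at most n. *)
Definition forest (n : nat) (F : edge_set n) : bool :=
  [forall c : {bseq n of 'I_n}, (2 < size c) ==> ~~ ucycleb (adj F) c].

Definition forest_partition (n : nat) (E : edge_set n)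
    (P : {set {set {set 'I_n}}}) : bool :=
  partition P E && [forall F in P, forest F].

(* The default value of the minimisation is the partition into single edges. *)
Definition arboricity (n : nat) (E : edge_set n) : nat :=
  #|[arg min_(P < [set [set e] | e in E] | forest_partition E P) #|P|]|.

(** * Partial edge colorings with palette 'I_q *)

Definition coloring (n q : nat) : predArgType := {ffun {set 'I_n} -> option 'I_q}.

Definition adjacent (n : nat) (e f : {set 'I_n}) : bool :=
  (e != f) && (e :&: f != set0).

Definition proper (n q : nat) (phi : coloring n q) : Prop :=
  forall e f, adjacent e f -> phi e != None -> phi e != phi f.

Definition recolor (n q : nat) (phi : coloring n q) (e : {set 'I_n})
    (c : option 'I_q) : coloring n q :=
  [ffun f => if f == e then c else phi f].

(* The colored edges are exactly those of E. *)
Definition edge_coloring (n q : nat) (E : edge_set n) (phi : coloring n q) : Prop :=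
  proper phi /\ (forall e, (phi e != None) = (e \in E)).

Definition recourse (n q : nat) (phi psi : coloring n q) : nat :=
  #|[set e | (phi e != None) && (psi e != phi e)]|.

(* [shift_augment phi e psi]: the uncolored edge e of phi is colored by shifts.
   A shift moves the color of an edge f adjacent to the uncolored edge e onto e,
   which makes f the uncolored edge; the coloring stays proper throughout.  At
   the end the uncolored edge receives a free color, which yields psi. *)
Inductive shift_augment (n q : nat) :
    coloring n q -> {set 'I_n} -> coloring n q -> Prop :=
| ShiftStop (phi : coloring n q) (e : {set 'I_n}) (c : 'I_q) :
    proper (recolor phi e (Some c)) ->
    shift_augment phi e (recolor phi e (Some c))
| ShiftStep (phi : coloring n q) (e f : {set 'I_n}) (psi : coloring n q) :
    adjacent e f -> phi f != None ->
    proper (recolor (recolor phi e (phi f)) f None) ->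
    shift_augment (recolor (recolor phi e (phi f)) f None) f psi ->
    shift_augment phi e psi.

(** * Word RAM programs

    Structured programs with registers and arrays indexed by nat (a given
    program mentions finitely many of them), executed on words smaller than a
    bound W: every value computed, and every array index, has to be smaller
    than W, otherwise the execution is stuck.  Each operation, register access
    and memory access has unit cost. *)

Record store := Store { reg : nat -> nat; arr : nat -> nat -> nat }.

Definition set_reg (s : store) (x k : nat) : store :=
  Store (fun y => if y == x then k else reg s y) (arr s).

Definition set_cell (s : store) (a i k : nat) : store :=
  Store (reg s)
    (fun b j => if (b == a) && (j == i) then k else arr s b j).

Inductive expr :=
| Cst of nat
| Reg of nat
| Cell of nat & expr
| Add of expr & expr
| Sub of expr & expr
| Mul of expr & expr
| Eqb of expr & expr
| Ltb of expr & expr.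

(* Sub is truncated; Eqb and Ltb return 0 or 1. *)
Fixpoint eval (s : store) (e : expr) : nat :=
  match e with
  | Cst k => k
  | Reg x => reg s x
  | Cell a i => arr s a (eval s i)
  | Add e1 e2 => eval s e1 + eval s e2
  | Sub e1 e2 => eval s e1 - eval s e2
  | Mul e1 e2 => eval s e1 * eval s e2
  | Eqb e1 e2 => eval s e1 == eval s e2
  | Ltb e1 e2 => eval s e1 < eval s e2
  end.

Fixpoint fits (W : nat) (s : store) (e : expr) : bool :=
  (eval s e < W) &&
  match e with
  | Cst _ | Reg _ => true
  | Cell _ i => fits W s i
  | Add e1 e2 | Sub e1 e2 | Mul e1 e2 | Eqb e1 e2 | Ltb e1 e2 =>
      fits W s e1 && fits W s e2
  end.

Fixpoint cost (e : expr) : nat :=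
  match e with
  | Cst _ | Reg _ => 1
  | Cell _ i => (cost i).+1
  | Add e1 e2 | Sub e1 e2 | Mul e1 e2 | Eqb e1 e2 | Ltb e1 e2 =>
      (cost e1 + cost e2).+1
  end.

Inductive cmd :=
| Skip
| SetReg of nat & expr
| SetCell of nat & expr & expr
| Seq of cmd & cmd
| If of expr & cmd & cmd
| While of expr & cmd.

(* [exec W s c t s']: started in s, the program c halts in s' after t steps. *)
Inductive exec (W : nat) : store -> cmd -> nat -> store -> Prop :=
| ExecSkip s : exec W s Skip 1 s
| ExecSetReg s x e :
    fits W s e ->
    exec W s (SetReg x e) (cost e).+1 (set_reg s x (eval s e))
| ExecSetCell s a i e :
    fits W s i -> fits W s e ->
    exec W s (SetCell a i e) (cost i + cost e).+1
      (set_cell s a (eval s i) (eval s e))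
| ExecSeq s1 s2 s3 c1 c2 t1 t2 :
    exec W s1 c1 t1 s2 -> exec W s2 c2 t2 s3 ->
    exec W s1 (Seq c1 c2) (t1 + t2) s3
| ExecIf s s' e c1 c2 t :
    fits W s e -> exec W s (if eval s e != 0 then c1 else c2) t s' ->
    exec W s (If e c1 c2) (cost e + t).+1 s'
| ExecWhileStop s e c :
    fits W s e -> eval s e = 0 ->
    exec W s (While e c) (cost e).+1 s
| ExecWhileStep s1 s2 s3 e c t1 t2 :
    fits W s1 e -> eval s1 e != 0 ->
    exec W s1 c t1 s2 -> exec W s2 (While e c) t2 s3 ->
    exec W s1 (While e c) (cost e + t1 + t2).+1 s3.

(** * Fully dynamic edge coloring *)

Inductive update (n : nat) := Insert of 'I_n & 'I_n | Delete of 'I_n & 'I_n.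

Definition applicable (n : nat) (E : edge_set n) (up : update n) : bool :=
  match up with
  | Insert u v => (u != v) && ([set u; v] \notin E)
  | Delete u v => [set u; v] \in E
  end.

Definition apply_update (n : nat) (E : edge_set n) (up : update n) : edge_set n :=
  match up with
  | Insert u v => [set u; v] |: E
  | Delete u v => E :\ [set u; v]
  end.

Definition within_bounds (n Delta alpha : nat) (E : edge_set n) : Prop :=
  (forall v, degree E v <= Delta) /\ arboricity E <= alpha.

Definition admissible (n Delta alpha : nat) (E : edge_set n) (up : update n) : Prop :=
  applicable E up /\ within_bounds Delta alpha (apply_update E up).

Record algorithm := Algorithm { on_insert : cmd; on_delete : cmd }.

Definition handler (A : algorithm) (n : nat) (up : update n) : cmd :=
  match up with Insert _ _ => on_insert A | Delete _ _ => on_delete A end.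

(* The memory is initially zero except for the parameters, in registers 0 to 3;
   the endpoints of the edge to be updated are passed in registers 4 and 5. *)
Definition init_store (n Delta C alpha : nat) : store :=
  Store (nth 0 [:: n; Delta; C; alpha]) (fun _ _ => 0).

Definition feed (n : nat) (up : update n) (s : store) : store :=
  match up with Insert u v | Delete u v => set_reg (set_reg s 4 u) 5 v end.

(* Words have O(log (n + Delta + C)) bits. *)
Definition word_bound (b n Delta C : nat) : nat := (n + Delta + C + 2) ^ b.

(* [run A b Delta C alpha E s]: some sequence of updates, keeping the graph
   within the bounds at all times, leads from the edgeless graph to E and the
   memory of A to s. *)
Inductive run (A : algorithm) (b n Delta C alpha : nat) :
    edge_set n -> store -> Prop :=
| RunInit : run A b Delta C alpha set0 (init_store n Delta C alpha)
| RunStep E s up t s' :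
    run A b Delta C alpha E s -> admissible Delta alpha E up ->
    exec (word_bound b n Delta C) (feed up s) (handler A up) t s' ->
    run A b Delta C alpha (apply_update E up) s'.

(* Array 0 displays the coloring as a symmetric n x n matrix, whose entries are
   0 on non-edges and c.+1 on the edges of color c. *)
Definition stores (n q : nat) (s : store) (phi : coloring n q) : Prop :=
  forall u v : 'I_n,
    arr s 0 (u * n + v) = if phi [set u; v] is Some c then (val c).+1 else 0.

(* A maintains a proper (Delta + C)-edge coloring, recoloring by shifts only,
   and processes each insertion in at most k * m steps (m being the number of
   edges, including the new one) with a recourse satisfying [bound].  Deleting
   an edge merely discards its color. *)
Definition maintains_coloring (A : algorithm) (b k n Delta C alpha : nat)
    (bound : nat -> Prop) : Prop :=
  forall (E : edge_set n) (s : store), run A b Delta C alpha E s ->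
  exists phi : coloring n (Delta + C),
    [/\ stores s phi, edge_coloring E phi &
     forall up : update n, admissible Delta alpha E up ->
     exists t s' (psi : coloring n (Delta + C)),
       [/\ exec (word_bound b n Delta C) (feed up s) (handler A up) t s',
           stores s' psi, edge_coloring (apply_update E up) psi &
           match up with
           | Insert u v =>
               [/\ t <= k * #|apply_update E up|, bound (recourse phi psi) &
                   shift_augment phi [set u; v] psi]
           | Delete u v => psi = recolor phi [set u; v] None
           end]].

(* Main.v *)
Require Import Defs.
From mathcomp Require Import all_boot all_order all_algebra.
From mathcomp Require Import reals exp.
From mathcomp Require Import zify ring.
Import Defs.

(** Let uv be the new, uncolored edge.  The algorithm searches the graph breadth
    first from v, the root being u.  When a vertex b is reached from its parent
    a, itself reached from g, shifting the colors along the search path makes ab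
    the uncolored edge, and the colors then free at a are those which were free
    before and the former color of ga: there are at least C + 1 of them.  If one
    of them is free at b, shifting along the path and coloring ab with it ends
    the update; otherwise each of them occurs on an edge bw, and every such w is
    reached next.  So if T_i is the set of the vertices at distance at most i
    and no color is found before distance i + 1, at least (C + 1)|T_i| pairs
    (b, w) of adjacent vertices lie in T_{i+1} with u added, while a set of
    k + 1 vertices contains at most 2 alpha k such pairs because a forest has
    fewer edges than vertices.  Hence |T_{i+1}| >= (C + 1)/(2 alpha) |T_i|, with
    (C + 1)/(2 alpha) >= 1 + eps/2, and the search stops at a distance
    O(log n / eps).

    To run in time O(m), the search decides whether b has a suitable color by
    counting the edges bw whose color is a candidate: if there are at most C of
    them, some candidate is missing at b. *)

Set Implicit Arguments.
Unset Strict Implicit.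
Unset Printing Implicit Defensive.
Local Open Scope nat_scope.

(** * Forests and arboricity *)

Section Graphs.
Variable n : nat.
Implicit Types (E F : edge_set n) (S : {set 'I_n}).

(** The search reads only the initial coloring, although the shifts alter it on the way. This is
    sound because a shift from [ab] to [bw] takes a free color away only at [a], which the path
    never meets again, and both edges that it changes contain [b]. Seen from a vertex further on,
    the coloring is still the initial one, except that the edge by which the path enters that vertex
    has just lost its color. The bound on the depth [r] is carried as the integer inequality
    [C.+1 ^ r <= (2 * alpha) ^ r * n], which makes sense for [alpha = 0] too; real numbers and
    logarithms enter only at the very end. For the time bound, every list that a loop of an
    insertion runs through consists of non-isolated vertices or of neighbors of one vertex, so that
    its length is controlled by the number of edges. Arrays indexed by all [n] vertices are never
    cleared as a whole. *)

Definition pairs E S := \sum_(x in S) \sum_(y in S) (adj E x y : nat).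

Definition simple E := forall e, e \in E -> exists u v, u != v /\ e = [set u; v].

Lemma simple_adj E x y : simple E -> adj E x y -> x != y.
Proof.
move=> sE /sE [u [v [neq eq]]]; apply: contraNneq neq => exy.
have /eqP := congr1 (fun A : {set _} => #|A|) eq.
rewrite exy setUid cards1 cards2; by case: (u == v).
Qed.

Lemma adjC E x y : adj E x y = adj E y x.
Proof. by rewrite /adj setUC. Qed.

(** If every vertex of [S] had two neighbors in [S], a path could be prolonged forever: the next
    vertex, chosen different from the previous one, is either new or closes a cycle. Paths are
    written backwards, with the growing end [x] in front. *)
Lemma forest_leaf F S : forest F -> simple F -> S != set0 ->
  exists2 x, x \in S & #|[set y in S | adj F x y]| <= 1.
Proof.
move=> fF sF /set0Pn [x0 x0S].
apply/exists_inP; apply: contraT; rewrite negb_exists_in => /forall_inP deg2.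
suff long k : exists x p, [/\ path (adj F) x p, uniq (x :: p),
    {subset x :: p <= S} & size p = k].
  have [x [p [_ uq _ sz]]] := long n.
  have := max_card (mem (x :: p)); rewrite (card_uniqP uq) card_ord /= sz; lia.
elim: k => [|k [x [p [pp up sub sz]]]].
  by exists x0, [::]; split=> // y; rewrite inE => /eqP->.
have xS : x \in S by apply: sub; rewrite mem_head.
(* [head x p] is the vertex before [x]; on a one-vertex path it is [x] itself, which is not its own
   neighbor. *)
have [y yS /andP[axy yneq]] : exists2 y, y \in S & adj F x y && (y != head x p).
  apply/exists_inP; apply: contraT; rewrite negb_exists_in => /forall_inP H.
  have /negP[] := deg2 x xS; rewrite -(cards1 (head x p)) subset_leq_card //.
  apply/subsetP => y; rewrite !inE => /andP[yS ay].
  by have := H y yS; rewrite ay /= negbK.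
have nxy := simple_adj sF axy.
case: (boolP (y \in x :: p)) => [|yp]; last first.
  exists y, (x :: p); split=> /=; rewrite ?sz //.
  - by rewrite adjC axy.
  - by rewrite yp.
  - by move=> z; rewrite inE => /orP[/eqP->//|]; apply: sub.
rewrite inE eq_sym (negPf nxy) /= => yp.
pose p1 := take (index y p).+1 p.
have ip : index y p < size p by rewrite index_mem.
have lastp1 : last x p1 = y.
  by rewrite /p1 (take_nth x ip) last_rcons nth_index.
(* As [y] is not the first vertex of [p], the cycle [x :: p1] has at least three vertices, which
   [forest] asks for. *)
have i0 : 0 < index y p.
  by case: (p) yneq yp => //= z r yneq _; rewrite eq_sym (negPf yneq).
have szp1 : size p1 = (index y p).+1 by rewrite size_takel.
have uc : ucycleb (adj F) (x :: p1).
  rewrite /ucycleb /= rcons_path lastp1 [adj F y x]adjC axy andbT.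
  have upx := up; rewrite -(cat_take_drop (index y p).+1 p) -/p1 in pp upx.
  move: pp; rewrite cat_path => /andP[-> _] /=.
  by move: upx; rewrite -cat_cons cat_uniq => /andP[].
have szc : size (x :: p1) <= n.
  case/andP: uc => _ uc; rewrite -(card_uniqP uc).
  by rewrite -[X in _ <= X]card_ord max_card.
have /forallP/(_ (Bseq szc)) := fF.
by rewrite /= uc implybF -leqNgt szp1 !ltnS leqNgt i0.
Qed.

(** Induction by removing a leaf. Pairs are ordered, so an edge counts twice and a leaf contributes
    at most 2. *)
Lemma forest_pairs F S : forest F -> simple F -> S != set0 ->
  pairs F S <= 2 * (#|S| - 1).
Proof.
move=> fF sF; move: {2}#|S| (erefl #|S|) => k; elim: k S => [|k IH] S cS S0.
  by move: S0; rewrite -card_gt0 cS.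
have [x xS dx] := forest_leaf fF sF S0.
pose S' := S :\ x.
have cS' : #|S'| = k by have := cardsD1 x S; rewrite xS cS => -[].
have sumS (G : 'I_n -> nat) : \sum_(y in S) G y = G x + \sum_(y in S') G y.
  rewrite (bigD1 x) //=; congr (_ + _); apply: eq_bigl => y.
  by rewrite !inE andbC.
have lxx : adj F x x = false.
  by apply/negP => /(simple_adj sF); rewrite eqxx.
have deg_sum : \sum_(y in S') (adj F x y : nat) <= 1.
  apply: leq_trans dx; rewrite -sum1_card big_mkcond /= [X in _ <= X]big_mkcond /=.
  by apply: leq_sum => y _; rewrite !inE; case: (y \in S); case: (adj _ _ _); case: (_ == _).
have eqp : pairs F S = 2 * \sum_(y in S') (adj F x y : nat) + pairs F S'.
  rewrite /pairs sumS sumS lxx add0n mul2n -addnn -addnA; congr (_ + _).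
  rewrite (eq_bigr (fun y => (adj F x y : nat) + \sum_(z in S') (adj F y z : nat))).
    by rewrite big_split.
  by move=> y _; rewrite sumS adjC.
case: (eqVneq S' set0) => [S'0|S'0].
  by rewrite eqp /pairs S'0 !big_set0.
have k0 : 0 < k by rewrite -cS' card_gt0.
by have := IH S' cS' S'0; rewrite eqp; lia.
Qed.

(** The default value in [arboricity] has to be a valid partition for the minimum to be attained by
    one. *)
Lemma forest_partition_single E : forest_partition E [set [set e] | e in E].
Proof.
apply/andP; split.
  apply/and3P; split.
  - rewrite /cover; apply/eqP/setP => e; apply/bigcupP/idP.
      by case=> A /imsetP[f fE ->]; rewrite inE => /eqP->.
    by move=> eE; exists [set e]; rewrite ?inE ?imset_f.
  - apply/trivIsetP => A B /imsetP[f _ ->] /imsetP[g _ ->].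
    by move=> neq; rewrite disjoints1 inE; apply: contra neq => /eqP->.
  - by apply/imsetP => -[f _ /setP/(_ f)]; rewrite !inE eqxx.
apply/forall_inP => A /imsetP[e _ ->]; apply/forallP => c; apply/implyP.
case: c => /= -[|x [|y [|z c]]] //= _ _; apply/negP.
rewrite /ucycleb /= /adj !inE => /andP[/and3P[/eqP e1 /eqP e2 _]].
have : x \in [set y; z] by rewrite e2 -e1 !inE eqxx.
by rewrite !inE !negb_or => /orP[] /eqP->; rewrite eqxx ?andbF.
Qed.

(** Every adjacent pair belongs to some forest of an optimal partition, and [forest_pairs] bounds
    the contribution of each forest. *)
Lemma arboricity_pairs E S : simple E -> S != set0 ->
  pairs E S <= 2 * arboricity E * (#|S| - 1).
Proof.
move=> sE S0; rewrite /arboricity.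
case: arg_minnP => [|P /andP[partP /forall_inP forP] _].
  exact: forest_partition_single.
have [/eqP covP _ _] := and3P partP.
have sP F : F \in P -> simple F.
  by move=> FP e eF; apply: sE; rewrite -covP; apply/bigcupP; exists F.
have -> : 2 * #|P| * (#|S| - 1) = \sum_(F in P) (2 * (#|S| - 1)).
  by rewrite sum_nat_const mulnAC mulnC.
apply: (@leq_trans (\sum_(F in P) pairs F S)); last first.
  by apply: leq_sum => F FP; apply: forest_pairs; [apply: forP|apply: sP|].
rewrite /pairs [X in _ <= X]exchange_big /=; apply: leq_sum => x xS.
rewrite [X in _ <= X]exchange_big /=; apply: leq_sum => y yS.
case: (boolP (adj E x y)) => // aE.
have : [set x; y] \in cover P by rewrite covP.
by case/bigcupP => F FP eF; rewrite (bigD1 F) //= /adj eF.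
Qed.

Lemma degree_adj E x : simple E -> degree E x = #|[set y | adj E x y]|.
Proof.
move=> sE; rewrite /degree.
have inj : {in [set y | adj E x y] &, injective (fun y => [set x; y])}.
  move=> y z; rewrite !inE => /(simple_adj sE) ny /(simple_adj sE) nz eq.
  have : y \in [set x; z] by rewrite -eq !inE eqxx orbT.
  by rewrite !inE eq_sym (negPf ny) /= => /eqP.
rewrite -(card_in_imset inj); apply: eq_card => e; apply/idP/imsetP.
  rewrite !inE => /andP[eE xe]; have [a [b [neq eq]]] := sE e eE.
  move: xe eE; rewrite eq !inE => /orP[] /eqP-> eE; [exists b|exists a] => //.
    by rewrite inE.
    by rewrite inE adjC.
  by rewrite setUC.
by case=> y; rewrite inE => aE ->; rewrite inE; apply/andP; split; rewrite ?inE ?eqxx.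
Qed.

Lemma sum_degree E : simple E -> \sum_x degree E x = 2 * #|E|.
Proof.
move=> sE; rewrite /degree.
rewrite (eq_bigr (fun x => \sum_(e in E) (x \in e : nat))); last first.
  move=> x _; rewrite -sum1_card big_mkcond /= [RHS]big_mkcond /=.
  by apply: eq_bigr => e _; rewrite inE; case: (e \in E); case: (x \in e).
rewrite exchange_big /= (eq_bigr (fun=> 2)) ?sum_nat_const 1?mulnC //.
move=> e /sE [u [v [neq ->]]].
rewrite (eq_bigr (fun x => if x \in [set u; v] then 1 else 0)); last first.
  by move=> x _; case: (_ \in _).
by rewrite -big_mkcond /= sum1_card cards2 neq.
Qed.

(** Each vertex of [l] contributes at least 1 to the degree sum. This turns lengths bounded by [n]
    into lengths bounded by the number of edges, as the running time requires. *)
Lemma size_non_isolated E (l : seq 'I_n) : simple E -> uniq l ->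
  (forall x, x \in l -> 0 < degree E x) -> size l <= 2 * #|E|.
Proof.
move=> sE ul dl; rewrite -sum_degree // -(card_uniqP ul) -sum1_card.
rewrite big_mkcond /=; apply: leq_sum => x _.
by case: ifP => // /dl.
Qed.

End Graphs.

(** * Free colors and sequences of shifts *)

Section Colorings.
Variables n q : nat.
Implicit Types (phi psi : coloring n q) (e f : {set 'I_n}) (a b p w x y : 'I_n) (c : 'I_q).

Definition free phi x c := [forall e : {set 'I_n}, (x \in e) ==> (phi e != Some c)].

(* The colors available at x once the color of px has been shifted away. *)
Definition cand phi p x c := free phi x c || (phi [set p; x] == Some c).

Definition candw phi p a b w :=
  if phi [set b; w] is Some c then cand phi p a c else false.

Lemma freeP phi x c : reflect (forall e : {set 'I_n}, x \in e -> phi e <> Some c) (free phi x c).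
Proof.
apply: (iffP forallP) => H e; first by move=> xe; have := H e; rewrite xe => /eqP.
by apply/implyP => xe; apply/eqP/H.
Qed.

Lemma freePn phi x c : reflect (exists2 e : {set 'I_n}, x \in e & phi e = Some c) (~~ free phi x c).
Proof.
rewrite negb_forall; apply: (iffP existsP) => -[e].
  by rewrite negb_imply negbK => /andP[xe /eqP]; exists e.
by move=> xe eq; exists e; rewrite negb_imply xe eq eqxx.
Qed.

Lemma proper_inj phi e f x c : proper phi -> x \in e -> x \in f ->
  phi e = Some c -> phi f = Some c -> e = f.
Proof.
move=> pp xe xf eqe eqf; apply/eqP; apply: contraT => neq.
have adj_ef : adjacent e f.
  by rewrite /adjacent neq; apply/set0Pn; exists x; rewrite inE xe.
by have := pp _ _ adj_ef; rewrite eqe eqf eqxx => /(_ isT).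
Qed.

Lemma proper_uncolor phi e : proper phi -> proper (recolor phi e None).
Proof.
move=> pp f g afg; rewrite !ffunE; case: (f =P e) => // _ Hf.
by case: (g =P e) => // _; apply: pp.
Qed.

Lemma proper_recolor phi a b c : proper phi -> free phi a c -> free phi b c ->
  proper (recolor phi [set a; b] (Some c)).
Proof.
move=> pp /freeP fa /freeP fb.
have key g : [set a; b] :&: g != set0 -> phi g <> Some c.
  by case/set0Pn => x; rewrite !inE => /andP[/orP[] /eqP->]; auto.
move=> f g /andP[neq I0]; rewrite !ffunE.
case: (f =P _) => [ef|_].
  case: (g =P _) => [eg|_ _]; first by rewrite ef eg eqxx in neq.
  by rewrite eq_sym; apply/eqP/key; rewrite -ef.
case: (g =P _) => [eg Hf|_ Hf].
  by apply/eqP/key; rewrite -eg setIC.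
by apply: pp => //; rewrite /adjacent neq.
Qed.

Lemma free_uncolor phi e x c c' : proper phi -> phi e = Some c' ->
  free (recolor phi e None) x c = ((c == c') && (x \in e)) || free phi x c.
Proof.
move=> pp pe; apply/freeP/idP.
  move=> H; case: (boolP (free _ _ _)) => [|/freePn[f xf pf]]; first by rewrite orbT.
  have := H f xf; rewrite ffunE; case: (f =P e) => [fe _|_ /(_ pf)//].
  have [->] : Some c = Some c' by rewrite -pf -pe fe.
  by rewrite eqxx -fe xf.
case/orP => [/andP[/eqP-> xe] f xf|/freeP H f xf].
  rewrite ffunE; case: eqP => // neq pf; apply: neq.
  exact: proper_inj pp xf xe pf pe.
by rewrite ffunE; case: eqP => // _; apply: H.
Qed.

Lemma free_recolor phi e x c c' : phi e = None ->
  free (recolor phi e (Some c')) x c = ~~ ((c == c') && (x \in e)) && free phi x c.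
Proof.
move=> pe; apply/freeP/andP.
  move=> H; split.
    apply/negP => /andP[/eqP cc xe]; have := H e xe.
    by rewrite ffunE eqxx cc.
  apply/freeP => f xf pf; have := H f xf; rewrite ffunE.
  by case: eqP => [fe|//]; rewrite fe pe in pf.
case=> N /freeP H f xf; rewrite ffunE; case: (f =P e) => [fe|_]; last exact: H.
by case=> cc; move: N; rewrite cc eqxx -fe xf.
Qed.

(** * Shifts along a path *)

Definition shift phi a b w : coloring n q :=
  recolor (recolor phi [set a; b] (phi [set b; w])) [set b; w] None.

Lemma neq_edge a b w : w != a -> w != b -> [set a; b] != [set b; w].
Proof.
move=> wa wb; apply/eqP => /setP/(_ w).
by rewrite !inE eqxx orbT (negPf wa) (negPf wb).
Qed.

(** The definition of [shift] follows [ShiftStep] and gives the same color to two adjacent edges on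
    the way. Uncoloring [bw] before coloring [ab] keeps the intermediate colorings proper, so that
    the lemmas on [free] apply to each half. *)
Lemma shiftE phi a b w : w != a -> w != b ->
  shift phi a b w =
  recolor (recolor phi [set b; w] None) [set a; b] (phi [set b; w]).
Proof.
move=> wa wb; apply/ffunP => e; rewrite !ffunE.
case: (e =P [set a; b]) => // ->.
by rewrite (negPf (neq_edge wa wb)).
Qed.

(* The path a, b, rest supports a sequence of shifts starting at the uncolored
   edge ab and ending with the color c; its conditions bear on the successive
   colorings, those of chain below on the initial one only. *)
Fixpoint good phi a b rest c : bool :=
  if rest is w :: r then
    (if phi [set b; w] is Some c' then free phi a c' else false) &&
    good (shift phi a b w) b w r c
  else free phi a c && free phi b c.

Fixpoint augment phi a b rest c : coloring n q :=
  if rest is w :: r then augment (shift phi a b w) b w r c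
  else recolor phi [set a; b] (Some c).

Fixpoint path_edges a b rest : seq {set 'I_n} :=
  [set a; b] :: (if rest is w :: r then path_edges b w r else [::]).

Lemma size_path_edges a b rest : size (path_edges a b rest) = (size rest).+1.
Proof. by elim: rest a b => //= w r IH a b; rewrite IH. Qed.

Lemma shift_none phi a b w : shift phi a b w [set b; w] = None.
Proof. by rewrite !ffunE eqxx. Qed.

Lemma proper_shift phi a b w c : proper phi -> w != a -> w != b ->
  phi [set b; w] = Some c -> free phi a c -> proper (shift phi a b w).
Proof.
move=> pp wa wb pbw fa; rewrite shiftE // pbw.
apply: proper_recolor; first exact: proper_uncolor.
  by rewrite (free_uncolor _ _ pp pbw) fa orbT.
by rewrite (free_uncolor _ _ pp pbw) eqxx !inE eqxx.
Qed.

(** The color moved from [bw] to [ab] was already used at [b], so [a] is the only vertex where it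
    can become newly used. *)
Lemma free_shift phi a b w x c : proper phi -> w != a -> w != b ->
  phi [set a; b] = None -> x != a ->
  free phi x c -> free (shift phi a b w) x c.
Proof.
move=> pp wa wb pab xa fx.
case E: (phi [set b; w]) => [c'|]; last first.
  apply/freeP => e xe; rewrite !ffunE; case: eqP => // _; case: eqP => _.
    by rewrite E.
  by move/freeP: fx; apply.
rewrite shiftE // E free_recolor; last by rewrite ffunE pab; case: ifP.
rewrite (free_uncolor _ _ pp E) fx orbT andbT !inE (negPf xa) /=.
apply/negP => /andP[/eqP cc /eqP xb]; move/freeP: fx => /(_ [set b; w]).
by rewrite !inE xb eqxx cc; apply.
Qed.

Lemma augmentP phi a b rest c : proper phi -> phi [set a; b] = None ->
  a != b -> uniq (a :: b :: rest) -> good phi a b rest c ->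
  let psi := augment phi a b rest c in
  [/\ shift_augment phi [set a; b] psi, proper psi,
      forall e, (psi e != None) = (e == [set a; b]) || (phi e != None) &
      forall e, e \notin path_edges a b rest -> psi e = phi e].
Proof.
elim: rest phi a b => [|w r IH] phi a b pp pab ab u /=.
  case/andP => fa fb; have pr := proper_recolor pp fa fb; split=> //.
  - exact: ShiftStop.
  - by move=> e; rewrite ffunE; case: (e =P _).
  - by move=> e; rewrite inE ffunE => /negPf->.
case E: (phi [set b; w]) => [c'|] //= /andP[fa g].
have [wa wb] : w != a /\ w != b.
  move: u => /=; rewrite !inE !negb_or => /andP[/and3P[_ aw _] /andP[/andP[bw _] _]].
  by rewrite ![w == _]eq_sym.
have ps := proper_shift pp wa wb E fa.
have ub : uniq (b :: w :: r) by move: u => /= /andP[_].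
rewrite eq_sym in wb.
have [sa ppsi dom out] := IH _ _ _ ps (shift_none phi a b w) wb ub g.
rewrite eq_sym in wb; have ne := neq_edge wa wb.
split=> //.
- apply: (@ShiftStep n q phi [set a; b] [set b; w]) => //; last by rewrite E.
  rewrite /adjacent ne; apply/set0Pn; exists b.
  by rewrite !inE eqxx orbT.
- move=> e; rewrite dom !ffunE.
  case: (e =P [set b; w]) => [->|_]; first by rewrite E orbT.
  by case: (e =P [set a; b]) => //=; rewrite E.
- move=> e; rewrite inE negb_or => /andP[ne1 ne2].
  rewrite out // !ffunE (negPf ne1); case: eqP => // e2.
  by move: ne2; rewrite e2; case: (r) => [|? ?]; rewrite /= inE eqxx.
Qed.

(** The path has [size rest + 1] edges, but the first one is uncolored in [phi] and does not count
    as recolored. *)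
Lemma recourse_augment phi a b rest c : proper phi -> phi [set a; b] = None ->
  a != b -> uniq (a :: b :: rest) -> good phi a b rest c ->
  recourse phi (augment phi a b rest c) <= size rest.
Proof.
move=> pp pab ab u g; have [_ _ _ out] := augmentP pp pab ab u g.
rewrite /recourse -ltnS -(size_path_edges a b rest).
set S := [set _ | _].
have abS : [set a; b] \notin S by rewrite inE pab.
have : #|[set a; b] |: S| <= size (path_edges a b rest).
  apply: leq_trans (card_size _); apply: subset_leq_card; apply/subsetP => e.
  rewrite !inE => /orP[/eqP->|/andP[_]]; first by case: (rest) => [|? ?]; rewrite /= inE eqxx.
  by apply: contraNT => /out->.
by rewrite cardsU1 abS.
Qed.

(** Here [p] precedes [a] on the path: the color of [pa] counts as available at [a] because an
    earlier shift will have moved it away. *)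
Fixpoint chain phi p a b rest c : bool :=
  if rest is w :: r then candw phi p a b w && chain phi a b w r c
  else cand phi p a c && free phi b c.

(** For a shift, [x0] is the only vertex losing free colors and [y0] the common vertex of the two
    changed edges; a path avoiding both keeps its conditions. The candidates at the first vertex
    form a separate hypothesis because [p] will be [y0]. *)
Lemma chain_mono phi psi (x0 y0 : 'I_n) p a b rest c :
  (forall x c, x != x0 -> free phi x c -> free psi x c) ->
  (forall e, y0 \notin e -> psi e = phi e) ->
  x0 \notin a :: b :: rest -> y0 \notin a :: b :: rest ->
  (forall c, cand phi p a c -> cand psi p a c) ->
  chain phi p a b rest c -> chain psi p a b rest c.
Proof.
move=> Hf He; elim: rest p a b => [|w r IH] p a b /=.
  rewrite !inE !negb_or => /andP[_ bx] _ Hc /andP[/Hc-> fb].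
  by rewrite Hf // eq_sym.
rewrite !(inE, negb_or) => /and3P[xa xb xr] /and3P[ya yb yr] Hc /andP[cw ch].
have /andP[yw _] := yr.
apply/andP; split.
  rewrite /candw He ?inE ?negb_or ?yb //.
  by move: cw; rewrite /candw; case: (phi _) => // c'; apply: Hc.
apply: IH ch; rewrite ?inE ?negb_or ?xb ?yb //.
move=> c' /orP[fb|/eqP eq]; first by rewrite /cand Hf // eq_sym.
by rewrite /cand He ?eq ?eqxx ?orbT // !inE negb_or ya.
Qed.

(** After one shift the remaining path satisfies the same conditions in the new coloring, so
    conditions on the initial coloring imply those on the successive ones. It is applied with [p]
    and [a] both equal to the root, the loop there being uncolored. *)
Lemma chain_good phi p a b rest c : proper phi -> phi [set a; b] = None ->
  phi [set p; a] = None ->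
  uniq (a :: b :: rest) -> chain phi p a b rest c -> good phi a b rest c.
Proof.
move=> pp pab pa.
have candE c0 : cand phi p a c0 = free phi a c0 by rewrite /cand pa orbF.
(* Since [pa] is uncolored, the candidates at [a] are its free colors. The induction runs on this
   form, in which [p] no longer occurs. *)
have : chain phi p a b rest c -> if rest is w :: r then
    (if phi [set b; w] is Some c' then free phi a c' else false) && chain phi a b w r c
    else free phi a c && free phi b c.
  case: rest => [|w r] /=; rewrite ?candE // /candw.
  by case: (phi _) => // c'; rewrite candE.
move=> H u {}/H; move: pp pab u {candE pa p}.
elim: rest phi a b => [//|w r IH] phi a b pp pab u.
have [wa wb] : w != a /\ w != b.
  move: u => /=; rewrite !inE !negb_or => /andP[/and3P[_ aw _] /andP[/andP[bw _] _]].
  by rewrite ![w == _]eq_sym.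
move=> /=; case E: (phi [set b; w]) => [c'|] //= /andP[fa ch]; rewrite fa /=.
have ps := proper_shift pp wa wb E fa.
have ub : uniq (b :: w :: r) by move: u => /= /andP[_].
have ba : b != a.
  by move: u => /=; rewrite !inE !negb_or eq_sym => /andP[/and3P[]].
apply: IH => //; first exact: shift_none.
have mono x c0 : x != a -> free phi x c0 -> free (shift phi a b w) x c0.
  by move=> xa; apply: free_shift.
have candE c0 : cand phi a b c0 = free phi b c0 by rewrite /cand pab orbF.
case: r ch u ub => [|w2 r2] /=.
  by rewrite candE => /andP[fb fw] _ _; rewrite !mono.
rewrite {1}/candw; move=> /andP[cw ch] u ub.
have neq : forall e, b \notin e -> shift phi a b w e = phi e.
  move=> e be; rewrite !ffunE; case: eqP => [ee|_].
    by move: be; rewrite ee !inE eqxx.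
  by case: eqP => // ee; move: be; rewrite ee !inE eqxx orbT.
have bn : b \notin [:: w, w2 & r2] by case/andP: ub.
rewrite neq; last first.
  by apply: contra bn; rewrite !inE orbA => ->.
case E2: (phi [set w; w2]) cw => [c2|] //; rewrite candE => fb.
rewrite mono //=.
apply: (chain_mono mono neq) ch => //.
  by move: u => /andP[]; rewrite inE negb_or => /andP[].
(* The former color of [bw] becomes free at [w] once [bw] is uncolored. *)
move=> c0 /orP[fw|/eqP]; first by rewrite /cand mono.
rewrite E => -[<-]; rewrite /cand shiftE // E free_recolor; last first.
  by rewrite ffunE pab; case: ifP.
by rewrite (free_uncolor _ _ pp E) eqxx !inE (negPf wa) (negPf wb) eqxx orbT.
Qed.

(** * Counting candidate colors and target vertices *)

(** Of the at most [D] edges at [a], the edge [e0] excludes no color, so at most [D - 1] of the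
    [D + C] colors are lost. At the root [e0] is the uncolored edge [uv]; elsewhere it is the edge
    by which the search entered [a]. *)
Lemma card_cand phi (E : edge_set n) D C p a e0 : q = D + C -> degree E a <= D ->
  (forall e, phi e != None -> e \in E) -> e0 \in E -> a \in e0 ->
  (forall c, phi e0 = Some c -> cand phi p a c) ->
  C < #|[set c | cand phi p a c]|.
Proof.
move=> qE dE pE e0E ae0 ce0.
pose De := [set e in E | a \in e] :\ e0.
have cDe : #|De| < D.
  apply: leq_trans dE; rewrite /degree (cardsD1 e0 [set e in E | a \in e]).
  by rewrite inE e0E ae0.
have : #|~: [set c | cand phi p a c]| <= #|De|.
  rewrite -(card_imset _ (@Some_inj _)); apply: leq_trans (leq_imset_card phi De).
  apply: subset_leq_card; apply/subsetP => o /imsetP[c]; rewrite !inE => nc ->.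
  move: (nc); rewrite /cand negb_or => /andP[/freePn[e ae pe] _].
  apply/imsetP; exists e => //; rewrite !inE ae pE ?pe // !andbT.
  by apply: contraNneq nc => ee; apply: ce0; rewrite -ee.
have := cardsC [set c | cand phi p a c]; rewrite card_ord; lia.
Qed.

Lemma exists_color phi (E : edge_set n) C p a b : simple E ->
  (forall e, phi e != None -> e \in E) ->
  C < #|[set c | cand phi p a c]| -> #|[set w | candw phi p a b w]| <= C ->
  exists c, cand phi p a c && free phi b c.
Proof.
move=> sE pE cc cw; apply/existsP; apply: contraT; rewrite negb_exists => /forallP H.
have : #|[set c | cand phi p a c]| <= #|[set w | candw phi p a b w]|; last by lia.
rewrite -(card_imset _ (@Some_inj _)).
apply: leq_trans (leq_imset_card (fun w => phi [set b; w]) _).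
apply: subset_leq_card; apply/subsetP => o /imsetP[c]; rewrite inE => ca ->.
have := H c; rewrite ca /= => /freePn[e be pe].
have eE : e \in E by apply: pE; rewrite pe.
have [x [y [_ exy]]] := sE e eE.
have [w ew] : exists w, e = [set b; w].
  move: be; rewrite exy !inE => /orP[] /eqP->; first by exists y.
  by exists x; rewrite setUC.
by apply/imsetP; exists w; rewrite -?ew ?pe // inE /candw -ew pe.
Qed.

Lemma card_free phi (E : edge_set n) b : (forall e, phi e != None -> e \in E) ->
  #|[set c | ~~ free phi b c]| <= #|E|.
Proof.
move=> pE; rewrite -(card_imset _ (@Some_inj _)); apply: leq_trans (leq_imset_card phi E).
apply: subset_leq_card; apply/subsetP => o /imsetP[c]; rewrite inE.
by case/freePn => e be pe ->; apply/imsetP; exists e; rewrite ?pE ?pe.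
Qed.

End Colorings.

(** The root lies outside [B]; adding it makes [#|u |: B| - 1] equal to [#|B|], so the bound on
    adjacent pairs has no correction term. *)
Lemma expansion n (E : edge_set n) C alpha (u : 'I_n) (A B : {set 'I_n})
    (K : 'I_n -> {set 'I_n}) :
  simple E -> arboricity E <= alpha -> A \subset B -> u \notin B ->
  (forall b, b \in A -> C < #|K b|) ->
  (forall b w, b \in A -> w \in K b -> adj E b w && (w \in u |: B)) ->
  C.+1 * #|A| <= 2 * alpha * #|B|.
Proof.
move=> sE aE AB uB cK sK.
have S0 : u |: B != set0 by apply/set0Pn; exists u; rewrite !inE eqxx.
have := arboricity_pairs sE S0; rewrite cardsU1 uB addKn => H.
have {}H : pairs E (u |: B) <= 2 * alpha * #|B|.
  by apply: leq_trans H _; rewrite leq_mul2r leq_mul2l aE !orbT.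
apply: leq_trans H; rewrite mulnC -sum_nat_const /pairs.
rewrite big_mkcond [X in _ <= X]big_mkcond /=; apply: leq_sum => b _.
case: ifP => // bA; rewrite inE (subsetP AB) // orbT.
apply: leq_trans (cK b bA) _; rewrite -sum1_card big_mkcond [X in _ <= X]big_mkcond /=.
apply: leq_sum => w _; case: ifP => // wK.
by have /andP[-> ->] := sK _ _ bA wK.
Qed.

(** * The search *)

Lemma sorted_cat_nseq (s : seq nat) k m : sorted leq s ->
  (forall x, x \in s -> x <= m) -> sorted leq (s ++ nseq k m).
Proof.
move=> ss sm; have pm y : y <= m -> path leq y (nseq k m).
  by elim: k y => //= k IH y ->; rewrite IH.
case: s ss sm => [|x s] /= ss sm; last first.
  by rewrite cat_path ss pm // sm // mem_last.
by case: k pm => //= k /(_ m); rewrite leqnn /= => ->.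
Qed.

Section Search.
Variables (n D C alpha : nat) (E : edge_set n) (phi : coloring n (D + C)) (u v : 'I_n).
Hypotheses (sE : simple E) (aE : arboricity E <= alpha) (dE : forall x, degree E x <= D).
Hypothesis alphaC : 2 * alpha <= C.
Hypothesis pE : forall e, (phi e != None) = (e \in E :\ [set u; v]).
Hypotheses (uv : u != v) (uvE : [set u; v] \in E).
Implicit Types (Q : seq 'I_n) (p : 'I_n -> 'I_n) (d : 'I_n -> nat).

(** The root is its own parent. For [b = v] the edge above the parent is thus the loop at [u], which
    is uncolored and adds no candidate, so that [v] needs no separate treatment. *)
Definition targets p b := [set w | candw phi (p (p b)) (p b) b w].

(* Q lists the vertices reached so far, the first h of which have been expanded;
   p and d give the parent and the depth in the search tree. *)
Record search_inv Q p d (h : nat) : Prop := SearchInv {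
  si_uniq : uniq (u :: Q);
  si_v : v \in Q;
  si_pu : p u = u;
  si_pv : p v = u;
  si_du : d u = 0;
  si_dv : d v = 1;
  si_par : forall w, w \in Q -> w != v ->
    [/\ p w \in take h Q, w \in targets p (p w) & d w = (d (p w)).+1];
  si_exp : forall b, b \in take h Q -> C < #|targets p b| /\
    forall w, w \in targets p b -> w \in u :: Q /\ d w <= (d b).+1;
  si_sorted : sorted leq (map d Q);
  si_bound : h < size Q -> forall w, w \in Q -> d w <= (d (nth u Q h)).+1;
  si_h : h <= size Q }.

Lemma search_init : search_inv [:: v] (fun=> u) (fun w => if w == u then 0 else 1) 0.
Proof.
split=> //=; rewrite ?inE ?eqxx //.
- by rewrite andbT.
- by rewrite eq_sym (negPf uv).
- by move=> w; rewrite inE => ->.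
- by move=> _ w _; case: ifP.
Qed.

Lemma phi_in e : phi e != None -> e \in E.
Proof. by rewrite pE => /setD1P[]. Qed.

Lemma phi_uv : phi [set u; v] = None.
Proof. by apply/eqP; apply: negPn; rewrite pE !inE eqxx. Qed.

Lemma phi_loop x : phi [set x; x] = None.
Proof.
apply/eqP; apply: negPn; apply/negP => /phi_in H.
by have := simple_adj sE (H : adj E x x); rewrite eqxx.
Qed.

Lemma candw_adj (g a b w : 'I_n) : candw phi g a b w -> adj E b w.
Proof.
by rewrite /candw; case ph: (phi _) => // _; apply: phi_in; rewrite ph.
Qed.

Section Inv.
Variables (Q : seq 'I_n) (p : 'I_n -> 'I_n) (d : 'I_n -> nat) (h : nat).
Hypothesis I : search_inv Q p d h.

Lemma si_mem_take x : x \in take h Q -> x \in Q.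
Proof. exact: mem_take. Qed.

Lemma si_p_closed w : w \in u :: Q -> p w \in u :: Q.
Proof.
rewrite inE => /orP[/eqP->|wQ]; first by rewrite (si_pu I) mem_head.
case: (eqVneq w v) => [->|wv]; first by rewrite (si_pv I) mem_head.
by have [/si_mem_take H _ _] := si_par I wQ wv; rewrite inE H orbT.
Qed.

Lemma si_p_adj w : w \in Q -> adj E (p w) w.
Proof.
move=> wQ; case: (eqVneq w v) => [->|wv]; first by rewrite (si_pv I).
by have [_ H _] := si_par I wQ wv; move: H; rewrite inE => /candw_adj.
Qed.

Lemma si_degree w : w \in Q -> 0 < degree E w.
Proof.
move=> wQ; rewrite degree_adj // card_gt0; apply/set0Pn; exists (p w).
by rewrite inE adjC si_p_adj.
Qed.

Lemma si_d_gt0 w : w \in Q -> 0 < d w.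
Proof.
move=> wQ; case: (eqVneq w v) => [->|wv]; first by rewrite (si_dv I).
by have [_ _ ->] := si_par I wQ wv.
Qed.

Lemma si_cand_card b : b \in Q -> C < #|[set c | cand phi (p (p b)) (p b) c]|.
Proof.
move=> bQ.
have : p b \in u :: Q by apply: si_p_closed; rewrite inE bQ orbT.
rewrite inE; case: (eqVneq (p b) u) => [->|pbu] /=.
  move=> _; apply: (@card_cand _ _ _ E D C _ _ [set u; v]) => //.
  - exact: phi_in.
  - by rewrite !inE eqxx.
  - by move=> c; rewrite phi_uv.
move=> pbQ; apply: (@card_cand _ _ _ E D C _ _ [set p (p b); p b]) => //.
- exact: phi_in.
- exact: si_p_adj.
- by rewrite !inE eqxx orbT.
- by move=> c eq; rewrite /cand eq eqxx orbT.
Qed.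

Lemma si_expansion (A B : {set 'I_n}) : A \subset [set w in take h Q] ->
  A \subset B -> B \subset [set w in Q] ->
  (forall b w, b \in A -> w \in targets p b -> w \in u |: B) ->
  C.+1 * #|A| <= 2 * alpha * #|B|.
Proof.
move=> AQ AB BQ H; apply: (@expansion n E C alpha u A B (targets p)) => //.
- apply/negP => /(subsetP BQ); rewrite inE => uQ.
  by have /= := si_uniq I; rewrite uQ.
- by move=> b /(subsetP AQ); rewrite inE => /(si_exp I)[].
- move=> b w bA wb; apply/andP; split; last exact: H wb.
  by move: wb; rewrite inE => /candw_adj.
Qed.

(** The search cannot fail: if every reached vertex had been expanded, [si_expansion] with both sets
    equal to the whole queue would give [C.+1 <= 2 * alpha]. *)
Lemma search_continues : h < size Q.
Proof.
rewrite ltnNge; apply/negP => hQ.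
have tQ : take h Q = Q by apply: take_oversize.
have : C.+1 * #|[set w in Q]| <= 2 * alpha * #|[set w in Q]|.
  apply: si_expansion; rewrite ?tQ //.
  move=> b w; rewrite inE -tQ => /(si_exp I)[_ H] /H[+ _].
  by rewrite tQ !inE.
have : 0 < #|[set w in Q]| by apply/card_gt0P; exists v; rewrite inE (si_v I).
by move=> c0; rewrite leq_pmul2r // leqNgt ltnS alphaC.
Qed.

Let hQ := search_continues.
Let b := nth u Q h.

(** The queue is sorted by depth, so whatever is shallower than the next vertex has already been
    expanded. *)
Lemma si_before w : w \in Q -> d w < d b -> w \in take h Q.
Proof.
move=> wQ; rewrite ltnNge; apply: contraNT => nw.
have iw : index w Q < size Q by rewrite index_mem.
have hw : h <= index w Q.
  rewrite leqNgt; apply: contra nw => ih.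
  by rewrite -(nth_index u wQ) -(nth_take u ih) mem_nth // size_take hQ.
have := sorted_leq_nth leq_trans leqnn 0 (si_sorted I) h (index w Q).
rewrite !inE !size_map => /(_ hQ iw hw).
by rewrite !(nth_map u) // nth_index.
Qed.

Let T i := [set w in Q | d w <= i].

(** Vertices of depth at most [i + 1] are expanded by [si_before], and their targets have depth at
    most [i + 2]. Indices are shifted because [v] has depth 1, which leaves [T 0] empty. *)
Lemma si_growth i : i < (d b).-1 ->
  C.+1 * #|T i.+1| <= 2 * alpha * #|T i.+2|.
Proof.
move=> ik; apply: si_expansion.
- apply/subsetP => w; rewrite !inE => /andP[wQ dw].
  by apply: si_before => //; lia.
- by apply/subsetP => w; rewrite !inE => /andP[-> /leqW].
- by apply/subsetP => w; rewrite !inE => /andP[].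
- move=> x w; rewrite !inE => /andP[xQ dx].
  have /(si_exp I)[_ H] : x \in take h Q by apply: si_before => //; lia.
  rewrite -in_set => wt; have [] := H w wt.
  by rewrite inE => /orP[->//|->] dw; apply/orP; right; lia.
Qed.

(** [si_growth] is iterated from the nonempty [T 1] up to a set of at most [n] vertices, multiplying
    instead of dividing by [2 * alpha]. *)
Lemma search_depth : C.+1 ^ (d b).-1 <= (2 * alpha) ^ (d b).-1 * n.
Proof.
suff H i : i <= (d b).-1 -> C.+1 ^ i <= (2 * alpha) ^ i * #|T i.+1|.
  apply: leq_trans (H _ (leqnn _)) _; rewrite leq_mul2l; apply/orP; right.
  by rewrite -[X in _ <= X]card_ord max_card.
elim: i => [_|i IH ib].
  rewrite !expn0 mul1n; apply/card_gt0P; exists v.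
  by rewrite !inE (si_v I) (si_dv I).
rewrite !expnS; apply: leq_trans (leq_mul (leqnn _) (IH (ltnW ib))) _.
set X := _ ^ i.
by rewrite (mulnCA C.+1) (mulnC (2 * alpha)) -(mulnA X) leq_mul2l (si_growth ib) orbT.
Qed.

(** Following parents from [x] back to [v] gives the path. Depth grows by one at each step, which
    yields both its length and the absence of repetitions. *)
Lemma search_path x : x \in Q ->
  exists rest, [/\ size rest = (d x).-1, uniq (u :: v :: rest), last v rest = x,
    path (fun y z => p z == y) v rest & {subset rest <= Q} /\
    forall c, cand phi (p (p x)) (p x) c -> free phi x c -> chain phi u u v rest c].
Proof.
move=> xQ; pose e := fun y z => [&& p z == y, z \in Q & z != v].
have : exists rest, [/\ size rest = (d x).-1, last v rest = x & path e v rest].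
  move: {2}(d x) (erefl (d x)) => k; elim: k x xQ => [|k IH] x xQ dx.
    by have := si_d_gt0 xQ; rewrite dx.
  case: (eqVneq x v) => [->|xv]; first by exists [::]; rewrite (si_dv I).
  have [/si_mem_take pQ _ dpx] := si_par I xQ xv.
  have [] := IH (p x) pQ; first by move: dpx; rewrite dx => -[].
  move=> r [sr lr pr]; exists (rcons r x); split.
  - by rewrite size_rcons sr dpx; have := si_d_gt0 pQ; lia.
  - by rewrite last_rcons.
  - by rewrite rcons_path pr lr /e eqxx xQ xv.
case=> r [sr lr pr]; exists r.
have rQ : {subset r <= Q}.
  move=> y; elim: r (v) {sr lr} pr => //= z r IH v0 /andP[/and3P[_ zQ _] pr].
  by rewrite inE => /orP[/eqP->//|/(IH z pr)].
have dpath : path (fun y z => d y < d z) v r.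
  elim: r (v) {sr lr rQ} pr => //= z r IH v0 /andP[/and3P[/eqP <- zQ zv] pr].
  by rewrite IH // andbT; have [_ _ ->] := si_par I zQ zv.
split=> //.
- rewrite /= inE negb_or uv; apply/and3P; split.
  + by apply/negP => /rQ uQ; have /= := si_uniq I; rewrite uQ.
  + have := order_path_min _ dpath; move=> /(_ (fun a b c => @ltn_trans _ _ _)).
    by move=> /allP H; apply/negP => /H; rewrite ltnn.
  + apply: (sorted_uniq (leT := fun y z => d y < d z)).
    * by move=> a0 b0 c0; apply: ltn_trans.
    * by move=> a0; rewrite ltnn.
    * exact: path_sorted dpath.
- by apply: sub_path pr => y z /and3P[].
split=> // c; rewrite -lr.
(* The start is generalized for the induction; at [v] both the parent and the grandparent are
   [u]. *)
suff H v0 : path e v0 r -> cand phi (p (p (last v0 r))) (p (last v0 r)) c ->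
    free phi (last v0 r) c -> chain phi (p (p v0)) (p v0) v0 r c.
  by have := H v pr; rewrite (si_pv I) (si_pu I).
elim: r v0 {sr lr rQ dpath pr} => [|w r IH] v0 /=; first by move=> _ -> ->.
move=> /andP[/and3P[/eqP pw wQ wv] pr] c1 c2.
have [_ + _] := si_par I wQ wv; rewrite inE pw => -> /=.
by have := IH w pr c1 c2; rewrite pw.
Qed.

Lemma search_color : #|targets p b| <= C ->
  exists c, cand phi (p (p b)) (p b) c && free phi b c.
Proof.
move=> H; apply: (exists_color sE phi_in _ H).
by apply: si_cand_card; apply: mem_nth.
Qed.

(** Parents of reached vertices are reached, so changing [p] and [d] outside [u :: Q] leaves earlier
    targets unchanged. By [si_bound] no earlier depth exceeds that of the new vertices, which keeps
    the queue sorted. *)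
Lemma search_step l : C < #|targets p b| -> uniq l ->
  (forall w, (w \in l) = (w \in targets p b) && (w \notin u :: Q)) ->
  search_inv (Q ++ l) (fun w => if w \in u :: Q then p w else b)
    (fun w => if w \in u :: Q then d w else (d b).+1) h.+1.
Proof.
move=> cb ul lE; set p' := fun w => _; set d' := fun w => _.
have bQ : b \in Q by apply: mem_nth.
have memc w : w \in Q -> w \in u :: Q by rewrite inE orbC => ->.
have tk : take h.+1 (Q ++ l) = rcons (take h Q) b.
  by rewrite takel_cat // (take_nth u hQ).
have p'E w : w \in u :: Q -> p' w = p w by rewrite /p' => ->.
have d'E w : w \in u :: Q -> d' w = d w by rewrite /d' => ->.
have tE w : w \in Q -> targets p' w = targets p w.
  move=> wQ; have wuQ := memc w wQ.
  by rewrite /targets (p'E w wuQ) p'E // si_p_closed.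
have tkQ w : w \in rcons (take h Q) b -> w \in Q.
  by rewrite mem_rcons inE => /orP[/eqP->//|/si_mem_take].
have uu : u \in u :: Q by rewrite mem_head.
have vv : v \in u :: Q by rewrite memc ?(si_v I).
have dl w : w \in l -> d' w = (d b).+1.
  by rewrite lE => /andP[_ /negPf H]; rewrite /d' H.
have dQ w : w \in Q ++ l -> d' w <= (d b).+1.
  rewrite mem_cat => /orP[wQ|/dl->//].
  by rewrite d'E ?memc //; apply: (si_bound I).
split.
- rewrite -cat_cons cat_uniq (si_uniq I) ul andbT /=.
  by apply/hasPn => w; rewrite lE => /andP[].
- by rewrite mem_cat (si_v I).
- by rewrite p'E // (si_pu I).
- by rewrite p'E // (si_pv I).
- by rewrite d'E // (si_du I).
- by rewrite d'E // (si_dv I).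
- move=> w; rewrite tk mem_cat => /orP[wQ wv|].
    have [pw tw dw] := si_par I wQ wv; have pQ := si_mem_take pw.
    rewrite p'E ?memc // d'E ?memc // d'E ?memc // tE //.
    by rewrite mem_rcons inE pw orbT.
  rewrite lE => /andP[wt wn] _; have p'w : p' w = b by rewrite /p' (negPf wn).
  rewrite p'w tE // mem_rcons mem_head; split=> //.
  by rewrite dl ?lE ?wt // d'E ?memc.
- move=> x; rewrite tk => xt; have xQ := tkQ x xt.
  rewrite tE // d'E ?memc //; move: xt; rewrite mem_rcons inE => /orP[/eqP->|xt].
    split=> // w wt; case: (boolP (w \in u :: Q)) => wn.
      split; first by rewrite -cat_cons mem_cat wn.
      rewrite d'E //; move: wn; rewrite inE => /orP[/eqP->|].
        by rewrite (si_du I).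
      by apply: (si_bound I).
    have wl : w \in l by rewrite lE wt.
    by rewrite dl // -cat_cons mem_cat wl orbT.
  have [cx H] := si_exp I xt; split=> // w /H[wQ dw].
  by rewrite -cat_cons mem_cat wQ d'E.
- rewrite map_cat; have -> : map d' Q = map d Q.
    by apply/eq_in_map => w wQ; rewrite d'E ?memc.
  have -> : map d' l = nseq (size l) (d b).+1.
    by rewrite -(size_map d'); apply/all_pred1P/allP => _ /mapP[w wl ->] /=; rewrite dl.
  apply: sorted_cat_nseq; first exact: si_sorted I.
  by move=> y /mapP[w wQ ->]; apply: (si_bound I).
- move=> hs w wQ; apply: leq_trans (dQ w wQ) _; rewrite ltnS.
  rewrite nth_cat; case: ltnP => hQ1.
    rewrite d'E ?memc ?mem_nth //.
    have := sorted_leq_nth leq_trans leqnn 0 (si_sorted I) h h.+1.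
    by rewrite !inE !size_map => /(_ hQ hQ1 (leqnSn _)); rewrite !(nth_map u).
  rewrite dl //; first by rewrite mem_nth // ltn_subLR // -size_cat.
- by rewrite size_cat; lia.
Qed.

End Inv.
End Search.

(** * A program logic with costs *)

(** A [run] provides some execution of each handler, while the triples below only assert that a good
    one exists; determinism identifies the two. *)
Lemma exec_det W s c t1 s1 t2 s2 :
  exec W s c t1 s1 -> exec W s c t2 s2 -> t1 = t2 /\ s1 = s2.
Proof.
move=> H; elim: H t2 s2 => {s c t1 s1}.
- by move=> s t2 s2 H; inversion H.
- by move=> s x e _ t2 s2 H; inversion H.
- by move=> s a i e _ _ t2 s2 H; inversion H.
- move=> s1 s2 s3 c1 c2 t1 t2 _ IH1 _ IH2 t s H.
  inversion H as [| | |? s2' ? ? ? t1' t2' H1 H2| | |]; subst.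
  by have [? ?] := IH1 _ _ H1; subst; have [? ?] := IH2 _ _ H2; subst.
- move=> s s' e c1 c2 t _ _ IH t2 s2 H.
  inversion H as [| | | |? ? ? ? ? t' _ H1| |]; subst.
  by have [-> ->] := IH _ _ H1.
- move=> s e c _ e0 t2 s2 H.
  inversion H as [| | | | |? ? ? _ e1|? s2' ? ? ? t1' t2' _ e1 H1 H2]; subst => //.
  by rewrite e0 in e1.
- move=> s1 s2 s3 e c t1 t2 _ e0 _ IH1 _ IH2 t s H.
  inversion H as [| | | | |? ? ? _ e1|? s2' ? ? ? t1' t2' _ _ H1 H2]; subst.
    by rewrite e1 in e0.
  by have [? ?] := IH1 _ _ H1; subst; have [? ?] := IH2 _ _ H2; subst.
Qed.

Fixpoint writes_reg (c : cmd) (x : nat) : bool :=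
  match c with
  | Skip | SetCell _ _ _ => false
  | SetReg y _ => x == y
  | Seq c1 c2 | If _ c1 c2 => writes_reg c1 x || writes_reg c2 x
  | While _ c => writes_reg c x
  end.

Fixpoint writes_arr (c : cmd) (a : nat) : bool :=
  match c with
  | Skip | SetReg _ _ => false
  | SetCell b _ _ => a == b
  | Seq c1 c2 | If _ c1 c2 => writes_arr c1 a || writes_arr c2 a
  | While _ c => writes_arr c a
  end.

(** Read off the program text, so that triples mention only what changes and the rest is settled by
    computation. *)
Definition frame (c : cmd) (s s' : store) : Prop :=
  (forall x, ~~ writes_reg c x -> reg s' x = reg s x) /\
  (forall a, ~~ writes_arr c a -> arr s' a = arr s a).

Lemma frame_trans c s1 s2 s3 : frame c s1 s2 -> frame c s2 s3 -> frame c s1 s3.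
Proof. by case=> H1 H2 [H3 H4]; split=> x H; rewrite (H3, H4) // (H1, H2). Qed.

Lemma frame_sub c c' s s' : frame c s s' ->
  (forall x, writes_reg c x -> writes_reg c' x) ->
  (forall x, writes_arr c x -> writes_arr c' x) -> frame c' s s'.
Proof.
by case=> H1 H2 H3 H4; split=> x H; rewrite (H1, H2) //; apply: contra H; auto.
Qed.

Lemma exec_frame W s c t s' : exec W s c t s' -> frame c s s'.
Proof.
elim=> {s c t s'} //.
- by move=> s x e _; split=> //= y /negPf->.
- by move=> s a i e _ _; split=> //= b /negPf->.
- move=> s1 s2 s3 c1 c2 t1 t2 _ H1 _ H2; apply: (@frame_trans _ _ s2).
    by apply: frame_sub H1 _ _ => x /= ->.
  by apply: frame_sub H2 _ _ => x /= ->; rewrite orbT.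
- move=> s s' e c1 c2 t _ _; case: (_ != 0) => H.
    by apply: frame_sub H _ _ => x /= ->.
  by apply: frame_sub H _ _ => x /= ->; rewrite orbT.
- by move=> s1 s2 s3 e c t1 t2 _ _ _ H1 _; apply: frame_trans.
Qed.

(* If the registers and cells hold values below N, then e evaluates to a value
   below N ^ expr_degree e; the large value rules out other constants than 0, 1. *)
Fixpoint expr_degree (e : expr) : nat :=
  match e with
  | Cst k => if k < 2 then 1 else 5
  | Reg _ | Cell _ _ | Eqb _ _ | Ltb _ _ => 1
  | Add e1 e2 => (maxn (expr_degree e1) (expr_degree e2)).+1
  | Sub e1 _ => expr_degree e1
  | Mul e1 e2 => expr_degree e1 + expr_degree e2
  end.

Fixpoint wf_expr (e : expr) : bool :=
  (expr_degree e <= 4) &&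
  match e with
  | Cst _ | Reg _ => true
  | Cell _ i => wf_expr i
  | Add e1 e2 | Sub e1 e2 | Mul e1 e2 | Eqb e1 e2 | Ltb e1 e2 =>
      wf_expr e1 && wf_expr e2
  end.

Fixpoint wf_cmd (c : cmd) : bool :=
  match c with
  | Skip => true
  | SetReg _ e => wf_expr e
  | SetCell _ i e => wf_expr i && wf_expr e
  | Seq c1 c2 => wf_cmd c1 && wf_cmd c2
  | If e c1 c2 => [&& wf_expr e, wf_cmd c1 & wf_cmd c2]
  | While e c => wf_expr e && wf_cmd c
  end.

(** An upper bound for loop-free programs, adding both branches of a conditional. On a loop it is
    the price of one test and one iteration, the unit of [hoare_for]. *)
Fixpoint scost (c : cmd) : nat :=
  match c with
  | Skip => 1
  | SetReg _ e => (cost e).+1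
  | SetCell _ i e => (cost i + cost e).+1
  | Seq c1 c2 => scost c1 + scost c2
  | If e c1 c2 => (cost e + (scost c1 + scost c2)).+1
  | While e c => (cost e + scost c).+1
  end.

Fixpoint loop_free (c : cmd) : bool :=
  match c with
  | Seq c1 c2 | If _ c1 c2 => loop_free c1 && loop_free c2
  | While _ _ => false
  | _ => true
  end.

Section Hoare.
Variable N : nat.
Hypothesis N_gt1 : 1 < N.

Definition small (s : store) : Prop :=
  (forall x, reg s x < N) /\ (forall a i, arr s a i < N).

(** Only stored values are compared with [N]; intermediate values stay below [N ^ 4] by [wf_cmd].
    Loops go through the rules [hoare_while] and [hoare_for] instead. *)
Fixpoint wp (c : cmd) (s : store) (Q : store -> Prop) : Prop :=
  match c with
  | Skip => Q s
  | SetReg x e => eval s e < N /\ Q (set_reg s x (eval s e))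
  | SetCell a i e => eval s e < N /\ Q (set_cell s a (eval s i) (eval s e))
  | Seq c1 c2 => wp c1 s (fun s' => wp c2 s' Q)
  | If e c1 c2 => if eval s e != 0 then wp c1 s Q else wp c2 s Q
  | While _ _ => False
  end.

Definition hoare (c : cmd) (s : store) (B : nat) (Q : store -> Prop) : Prop :=
  exists t s', [/\ exec (N ^ 4) s c t s', t <= B, small s' & Q s'].

Lemma eval_small s e : small s -> wf_expr e -> eval s e < N ^ expr_degree e.
Proof.
case=> sr sa; have N0 : 0 < N by apply: ltnW.
have b1 (b : bool) : (b : nat) < N by case: b.
elim: e => //=.
- by move=> k; case: ifP => // k2 _; rewrite expn1; apply: leq_trans k2 _.
- move=> e1 H1 e2 H2 /and3P[_ /H1{}H1 /H2{}H2]; rewrite expnS.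
  (* A sum is at most twice the larger bound, which one more factor [N >= 2] absorbs. *)
  set m := maxn _ _; have : 2 * N ^ m <= N * N ^ m by rewrite leq_mul2r N_gt1 orbT.
  have : N ^ expr_degree e1 <= N ^ m by rewrite leq_pexp2l ?leq_maxl.
  have : N ^ expr_degree e2 <= N ^ m by rewrite leq_pexp2l ?leq_maxr.
  lia.
- move=> e1 H1 e2 _ /and3P[_ /H1{}H1 _]; lia.
- move=> e1 H1 e2 H2 /and3P[_ /H1{}H1 /H2{}H2]; rewrite expnD.
  exact: ltn_mul.
Qed.

Lemma wf_fits s e : small s -> wf_expr e -> fits (N ^ 4) s e.
Proof.
move=> ss; have N0 : 0 < N by apply: ltnW.
have key e' : wf_expr e' -> eval s e' < N ^ 4.
  move=> we; apply: leq_trans (eval_small ss we) _; rewrite leq_pexp2l //.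
  by case: e' we => //= *; lia.
elim: e => [k|x|a i IH|e1 H1 e2 H2|e1 H1 e2 H2|e1 H1 e2 H2|e1 H1 e2 H2|e1 H1 e2 H2] we;
  (apply/andP; split; first exact: key); case/andP: we => // _.
all: by case/andP=> w1 w2; apply/andP; split; [exact: H1 | exact: H2].
Qed.

Lemma small_set_reg s x k : small s -> k < N -> small (set_reg s x k).
Proof. by case=> sr sa kN; split=> //= y; case: ifP. Qed.

Lemma small_set_cell s a i k : small s -> k < N -> small (set_cell s a i k).
Proof. by case=> sr sa kN; split=> //= b j; case: ifP. Qed.

Lemma hoare_frame c s B Q : hoare c s B Q -> hoare c s B (fun s' => frame c s s' /\ Q s').
Proof.
case=> t [s' [ex tB ss q]]; exists t, s'; split=> //; split=> //.
exact: exec_frame ex.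
Qed.

Lemma hoare_weaken c s B B' (Q Q' : store -> Prop) : hoare c s B Q -> B <= B' ->
  (forall s', small s' -> frame c s s' -> Q s' -> Q' s') -> hoare c s B' Q'.
Proof.
move=> /hoare_frame[t [s' [ex tB ss [fr q]]]] BB H; exists t, s'; split=> //.
  exact: leq_trans BB.
exact: H.
Qed.

Lemma hoare_seq c1 c2 s B1 B2 (R Q : store -> Prop) : hoare c1 s B1 R ->
  (forall s', small s' -> frame c1 s s' -> R s' -> hoare c2 s' B2 Q) ->
  hoare (Seq c1 c2) s (B1 + B2) Q.
Proof.
move=> /hoare_frame[t1 [s1 [ex1 tB1 ss1 [fr r]]]] H.
have [t2 [s2 [ex2 tB2 ss2 q]]] := H s1 ss1 fr r.
exists (t1 + t2), s2; split=> //; last exact: leq_add.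
exact: ExecSeq ex1 ex2.
Qed.

Lemma wp_hoare c s (Q : store -> Prop) : wf_cmd c -> loop_free c -> small s -> wp c s Q ->
  hoare c s (scost c) Q.
Proof.
elim: c s Q => //=.
- by move=> s Q _ _ ss q; exists 1, s; split=> //; constructor.
- move=> x e s Q we _ ss [eN q]; eexists _, _; split; last exact: q.
  + by apply: ExecSetReg; apply: wf_fits.
  + by [].
  + exact: small_set_reg.
- move=> a i e s Q /andP[wi we] _ ss [eN q]; eexists _, _; split; last exact: q.
  + by apply: ExecSetCell; apply: wf_fits.
  + by [].
  + exact: small_set_cell.
- move=> c1 H1 c2 H2 s Q /andP[w1 w2] /andP[l1 l2] ss w.
  by apply: hoare_seq (H1 _ _ w1 l1 ss w) _ => s' ss' _; apply: H2.
- move=> e c1 H1 c2 H2 s Q /and3P[we w1 w2] /andP[l1 l2] ss w.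
  have [t [s' [ex tB ss' q]]] :
      hoare (if eval s e != 0 then c1 else c2) s (scost c1 + scost c2) Q.
    move: w; case: ifP => _ w.
      by apply: hoare_weaken (H1 _ _ w1 l1 ss w) _ _ => //; apply: leq_addr.
    by apply: hoare_weaken (H2 _ _ w2 l2 ss w) _ _ => //; apply: leq_addl.
  exists (cost e + t).+1, s'; split=> //; last by rewrite ltnS leq_add2l.
  by apply: ExecIf => //; apply: wf_fits.
Qed.

(** Amortized rule: the index of the invariant is the time still available, so iterations may have
    different costs, as when expanding a vertex costs its degree. *)
Lemma hoare_while e c s0 m (I : nat -> store -> Prop) (Q : store -> Prop) :
  wf_expr e -> small s0 -> I m s0 ->
  (forall s k, small s -> frame c s0 s -> I k s -> eval s e = 0 -> cost e < k /\ Q s) ->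
  (forall s k, small s -> frame c s0 s -> I k s -> eval s e != 0 ->
     exists B, hoare c s B (fun s' => exists k', I k' s' /\ (cost e + B).+1 + k' <= k)) ->
  hoare (While e c) s0 m Q.
Proof.
move=> we ss0 I0 Hstop Hstep.
(* Each iteration uses up a positive part of the time left, so induction on that time also yields
   termination. *)
suff H k s k' : small s -> I k' s -> k' < k -> frame c s0 s -> hoare (While e c) s k' Q.
  exact: (H m.+1).
elim: k s k' {m ss0 I0} => // k IH s m ss Is mk fr.
case: (eqVneq (eval s e) 0) => [e0|e0].
  have [cm q] := Hstop _ _ ss fr Is e0.
  by exists (cost e).+1, s; split=> //; apply: ExecWhileStop => //; apply: wf_fits.
have [B /hoare_frame[t1 [s1 [ex1 tB1 ss1 [fr1 [k' [I1 le1]]]]]]] := Hstep _ _ ss fr Is e0.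
have [|t2 [s2 [ex2 tB2 ss2 q]]] := IH s1 k' ss1 I1 _ (frame_trans fr fr1); first by lia.
exists (cost e + t1 + t2).+1, s2; split=> //; last by lia.
by apply: ExecWhileStep ex1 ex2 => //; apply: wf_fits.
Qed.

(** Here the index bounds the number of iterations left; the extra unit in [r.+1] pays for the final
    test. *)
Lemma hoare_for e c s0 r (I : nat -> store -> Prop) (Q : store -> Prop) :
  wf_expr e -> wf_cmd c -> loop_free c -> small s0 -> I r s0 ->
  (forall s k, small s -> frame c s0 s -> I k s ->
     if eval s e == 0 then Q s
     else 0 < k /\ wp c s (fun s' => exists2 k', k' < k & I k' s')) ->
  hoare (While e c) s0 (scost (While e c) * r.+1) Q.
Proof.
move=> we wc lc ss0 I0 H; set w := scost _.
pose J m s := exists2 r', I r' s & m = w * r'.+1.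
have w0 : cost e < w by rewrite /w /= ltnS leq_addr.
apply: (@hoare_while e c s0 _ J) => //; first by exists r.
  move=> s k ss fr [r' Ir ->] e0; have := H s r' ss fr Ir; rewrite e0 eqxx.
  by split=> //; rewrite mulnS; lia.
move=> s k ss fr [r' Ir ->] e0; have := H s r' ss fr Ir; rewrite (negPf e0).
case=> r0 W; exists (scost c).
apply: hoare_weaken (wp_hoare wc lc ss W) _ _ => // s' _ _ [k' k'r Ik].
exists (w * k'.+1); split; first by exists k'.
rewrite -/(scost (While e c)) -/w (mulnS w r').
by rewrite leq_add2l leq_mul2l k'r orbT.
Qed.

End Hoare.

(** * Memory layout *)

(* Arrays: 0 colors; 1 flags of the colors used at a vertex, at index
   x * (q + 1) + c + 1 for the vertex x and the color c of a palette of size q;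
   2 and 3 adjacency lists and their lengths; 4 parent plus 1 (0 if not reached);
   5 queue; 6 successor on the path to the vertex where the search ended.
   Register 6 holds q + 1. *)
Definition mat (x y : expr) : expr := Add (Mul x (Reg 0)) y.
Definition tab (x c : expr) : expr := Add (Mul x (Reg 6)) c.
Definition incr (x : nat) : cmd := SetReg x (Add (Reg x) (Cst 1)).

(* Sets the color plus 1 of the edge xy to k, and marks the color c - 1 as used
   (flag 1) or unused (flag 0) at x and y. *)
Definition paint (x y c : nat) (k : expr) (flag : nat) : cmd :=
  Seq (SetCell 0 (mat (Reg x) (Reg y)) k)
  (Seq (SetCell 0 (mat (Reg y) (Reg x)) k)
  (Seq (SetCell 1 (tab (Reg x) (Reg c)) (Cst flag))
       (SetCell 1 (tab (Reg y) (Reg c)) (Cst flag)))).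

Definition color_edge x y c := paint x y c (Reg c) 1.
Definition uncolor_edge x y c := paint x y c (Cst 0) 0.

Lemma index_eq m x x' y y' : y < m -> y' < m ->
  (x * m + y == x' * m + y') = (x == x') && (y == y').
Proof.
move=> ym y'm; apply/eqP/andP => [H|[/eqP-> /eqP->]] //.
have m0 : 0 < m by apply: leq_ltn_trans ym.
have := congr1 (divn^~ m) H; have := congr1 (modn^~ m) H.
by rewrite /= !modnMDl !divnMDl // !modn_small // !divn_small // !addn0 => -> ->.
Qed.

Lemma wp_seq N c1 c2 s Q :
  wp N c1 s (fun s' => wp N c2 s' Q) -> wp N (Seq c1 c2) s Q.
Proof. by []. Qed.

Lemma wp_set_reg N x e k s (Q : store -> Prop) : eval s e = k -> k < N ->
  Q (set_reg s x k) -> wp N (SetReg x e) s Q.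
Proof. by move=> <-. Qed.

Section Memory.
Variables n q N : nat.
Hypotheses (nN : n <= N) (qN : q.+1 < N).
Implicit Types (phi : coloring n q) (x y w : 'I_n) (c : 'I_q).

Definition code (o : option 'I_q) : nat := if o is Some c then c.+1 else 0.

Definition stores_colors (M : nat -> nat) phi :=
  forall x y, M (x * n + y) = code (phi [set x; y]).

Definition stores_used (T : nat -> nat) phi :=
  forall x c, T (x * q.+1 + c.+1) = ~~ free phi x c.

Definition stores_nbrs (A L : nat -> nat) (nb : 'I_n -> seq 'I_n) :=
  forall x, L x = size (nb x) /\ forall j, j < size (nb x) -> A (x * n + j) = nth x (nb x) j.

Definition stores_phi s phi := stores_colors (arr s 0) phi /\ stores_used (arr s 1) phi.

Lemma stores_phi_eq s s' phi : arr s' 0 = arr s 0 -> arr s' 1 = arr s 1 ->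
  stores_phi s phi -> stores_phi s' phi.
Proof. by rewrite /stores_phi => -> ->. Qed.

Lemma edge_eq x y x' y' : ([set x; y] == [set x'; y']) =
  (x == x') && (y == y') || (x == y') && (y == x').
Proof.
apply/eqP/orP => [H|[/andP[/eqP-> /eqP->]|/andP[/eqP-> /eqP->]]] //; last by rewrite setUC.
have H1 := in_set2 x x' y'; have H2 := in_set2 y x' y'.
have H3 := in_set2 x' x y; have H4 := in_set2 y' x y.
rewrite -H !inE !eqxx ?orbT /= in H1 H2; rewrite H !inE !eqxx ?orbT /= in H3 H4.
rewrite ![x' == _]eq_sym in H3; rewrite ![y' == _]eq_sym in H4.
apply/orP; move: H1 H2 H3 H4.
by case: (x == x'); case: (x == y'); case: (y == x'); case: (y == y').
Qed.

Lemma stores_colors_recolor M x y phi o : stores_colors M phi ->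
  stores_colors (fun j => if j == y * n + x then code o else
    if j == x * n + y then code o else M j) (recolor phi [set x; y] o).
Proof.
move=> HM x' y'; rewrite !index_eq ?ltn_ord // !ffunE edge_eq HM.
do 4! rewrite -(inj_eq val_inj) /=.
by case: (_ == _ :> nat); case: (_ == _ :> nat); case: (_ == _ :> nat); case: (_ == _ :> nat).
Qed.

Lemma wp_color_edge s rx ry rc x y c phi (Q : store -> Prop) :
  reg s 0 = n -> reg s 6 = q.+1 ->
  reg s rx = x -> reg s ry = y -> reg s rc = c.+1 ->
  stores_phi s phi -> phi [set x; y] = None ->
  (forall s', reg s' = reg s -> (forall a, 1 < a -> arr s' a = arr s a) ->
    stores_phi s' (recolor phi [set x; y] (Some c)) -> Q s') ->
  wp N (color_edge rx ry rc) s Q.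
Proof.
move=> r0 r6 ex ey ec [HM HT] pxy HQ; have cN : c.+1 < N.
  by apply: leq_ltn_trans (ltn_ord c) _; apply: ltnW.
rewrite /= r0 r6 ex ey ec; split=> //; split=> //; split; first by lia.
split; first by lia.
apply: HQ => //; first by case=> [|[|a]].
split; first exact: (stores_colors_recolor x y (Some c)).
move=> x' c' /=; rewrite !index_eq ?ltnS // free_recolor // HT !inE !eqSS.
rewrite -!(inj_eq val_inj) /= ![_ == c :> nat]eq_sym.
by do 3![case: (_ == _ :> nat)].
Qed.

Lemma wp_uncolor_edge s rx ry rc x y c phi (Q : store -> Prop) :
  reg s 0 = n -> reg s 6 = q.+1 ->
  reg s rx = x -> reg s ry = y -> reg s rc = c.+1 ->
  stores_phi s phi -> proper phi -> phi [set x; y] = Some c ->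
  (forall s', reg s' = reg s -> (forall a, 1 < a -> arr s' a = arr s a) ->
    stores_phi s' (recolor phi [set x; y] None) -> Q s') ->
  wp N (uncolor_edge rx ry rc) s Q.
Proof.
move=> r0 r6 ex ey ec [HM HT] pp pxy HQ.
rewrite /= r0 r6 ex ey ec; split; first by lia.
split; first by lia.
split; first by lia.
split; first by lia.
apply: HQ => //; first by case=> [|[|a]].
split; first exact: (stores_colors_recolor x y None).
move=> x' c' /=; rewrite !index_eq ?ltnS // (free_uncolor _ _ pp pxy) HT !inE !eqSS.
rewrite -!(inj_eq val_inj) /= ![_ == c :> nat]eq_sym.
by do 3![case: (_ == _ :> nat)].
Qed.

End Memory.

(** * Insertions *)

(* Registers: 7, 8 start and end of the queue; 9 flag of success; 10 vertex b
   being expanded; 11 its parent a; 12 color plus 1 of the edge from a to its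
   parent (0 if there is none); 13 number of candidate colors met around b. *)
Definition is_cand (c : expr) : expr :=
  Add (Eqb (Cell 1 (tab (Reg 11) c)) (Cst 0)) (Eqb c (Reg 12)).

Definition visit_body : cmd :=
  Seq (SetReg 15 (Cell 2 (mat (Reg 10) (Reg 14))))
  (Seq (SetReg 16 (Cell 0 (mat (Reg 10) (Reg 15))))
  (Seq (If (is_cand (Reg 16))
         (Seq (incr 13)
           (If (Eqb (Cell 4 (Reg 15)) (Cst 0))
             (Seq (SetCell 4 (Reg 15) (Add (Reg 10) (Cst 1)))
             (Seq (SetCell 5 (Reg 8) (Reg 15)) (incr 8)))
             Skip))
         Skip)
       (incr 14))).

Definition visit : cmd := While (Ltb (Reg 14) (Cell 3 (Reg 10))) visit_body.

Definition dequeue : cmd :=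
  Seq (SetReg 10 (Cell 5 (Reg 7)))
  (Seq (SetReg 11 (Sub (Cell 4 (Reg 10)) (Cst 1)))
  (Seq (SetReg 12 (Cell 0 (mat (Sub (Cell 4 (Reg 11)) (Cst 1)) (Reg 11))))
  (Seq (SetReg 13 (Cst 0)) (SetReg 14 (Cst 0))))).

Definition decide : cmd :=
  If (Ltb (Reg 13) (Add (Reg 2) (Cst 1))) (SetReg 9 (Cst 1)) (incr 7).

Definition search_body : cmd := Seq dequeue (Seq visit decide).

Definition search : cmd := While (Eqb (Reg 9) (Cst 0)) search_body.

Definition search_start : cmd :=
  Seq (SetReg 6 (Add (Add (Reg 1) (Reg 2)) (Cst 1)))
  (Seq (SetCell 4 (Reg 4) (Add (Reg 4) (Cst 1)))
  (Seq (SetCell 4 (Reg 5) (Add (Reg 4) (Cst 1)))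
  (Seq (SetCell 5 (Cst 0) (Reg 5))
  (Seq (SetReg 7 (Cst 0)) (Seq (SetReg 8 (Cst 1)) (SetReg 9 (Cst 0))))))).

Definition scan : cmd :=
  While (Add (Ltb (Cst 0) (Cell 1 (tab (Reg 10) (Reg 16))))
             (Eqb (is_cand (Reg 16)) (Cst 0)))
    (incr 16).

(** Parents lead from the end of the path back to [u], while the shifts start at [uv], hence the
    reversal into array 6. *)
Definition link : cmd :=
  While (Eqb (Eqb (Reg 18) (Reg 4)) (Cst 0))
    (Seq (SetReg 17 (Sub (Cell 4 (Reg 18)) (Cst 1)))
    (Seq (SetCell 6 (Reg 17) (Reg 18)) (SetReg 18 (Reg 17)))).

(** Uncoloring comes first, as in [shiftE]: the flag of the moved color at the middle vertex is
    cleared and then set again. *)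
Definition shift_body : cmd :=
  Seq (SetReg 15 (Cell 6 (Reg 18)))
  (Seq (SetReg 19 (Cell 0 (mat (Reg 18) (Reg 15))))
  (Seq (uncolor_edge 18 15 19)
  (Seq (color_edge 17 18 19)
  (Seq (SetReg 17 (Reg 18)) (SetReg 18 (Reg 15)))))).

Definition shift_loop : cmd := While (Eqb (Eqb (Reg 18) (Reg 10)) (Cst 0)) shift_body.

(** Array 4 has to be zero before the next search. Only the entries of queued vertices are reset,
    since wiping all [n] of them would exceed O(m). *)
Definition cleanup : cmd :=
  While (Ltb (Reg 14) (Reg 8)) (Seq (SetCell 4 (Cell 5 (Reg 14)) (Cst 0)) (incr 14)).

Definition add_nbr (x y : nat) : cmd :=
  Seq (SetCell 2 (mat (Reg x) (Cell 3 (Reg x))) (Reg y))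
      (SetCell 3 (Reg x) (Add (Cell 3 (Reg x)) (Cst 1))).

Definition insertion : cmd :=
  Seq search_start
  (Seq search
  (Seq (SetReg 16 (Cst 1))
  (Seq scan
  (Seq (SetReg 18 (Reg 10))
  (Seq link
  (Seq (Seq (SetReg 17 (Reg 4)) (SetReg 18 (Reg 5)))
  (Seq shift_loop
  (Seq (Seq (color_edge 17 18 16) (SetReg 14 (Cst 0)))
  (Seq cleanup
  (Seq (SetCell 4 (Reg 4) (Cst 0)) (Seq (add_nbr 4 5) (add_nbr 5 4)))))))))))).

Lemma sum_nat_split (T : finType) (P : pred T) (F : T -> nat) x : P x ->
  \sum_(y | P y) F y = F x + \sum_(y | P y && (y != x)) F y.
Proof. by move=> Px; rewrite (bigD1 x). Qed.

Definition push_nbr n (nb : 'I_n -> seq 'I_n) (x y z : 'I_n) :=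
  if z == x then rcons (nb x) y else nb z.

Lemma uniq_size_ord m (t : seq 'I_m) : uniq t -> size t <= m.
Proof. by move=> ut; rewrite -(card_uniqP ut) -[X in _ <= X]card_ord max_card. Qed.

Lemma wp_add_nbr n N s rx ry (x y : 'I_n) nb (Q : store -> Prop) :
  n < N -> reg s 0 = n -> reg s rx = x -> reg s ry = y ->
  stores_nbrs (arr s 2) (arr s 3) nb ->
  (forall z, uniq (nb z)) -> y \notin nb x ->
  (forall s', reg s' = reg s ->
    (forall a, (a != 2) && (a != 3) -> arr s' a = arr s a) ->
    stores_nbrs (arr s' 2) (arr s' 3) (push_nbr nb x y) -> Q s') ->
  wp N (add_nbr rx ry) s Q.
Proof.
move=> nN r0 ex ey HN un yx HQ; have [sx Hx] := HN x.
have szx : size (nb x) < n.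
  by have := @uniq_size_ord _ (y :: nb x); rewrite /= yx un; apply.
rewrite /= ex ey r0 sx addn1; split; first by apply: ltn_trans nN.
split; first by apply: leq_ltn_trans nN.
apply: HQ => //; first by case=> [|[|[|[|a]]]].
move=> z; have [sz Hz] := HN z; have uz := uniq_size_ord (un z); split=> /=.
  rewrite /push_nbr -(inj_eq val_inj) /=; case: (z =P x :> nat) => // _.
  by rewrite size_rcons.
move=> j; rewrite /push_nbr; case: (eqVneq z x) => [->|zx].
  rewrite size_rcons ltnS leq_eqVlt => /orP[/eqP->|jx].
    by rewrite eqxx nth_rcons ltnn eqxx.
  by rewrite index_eq ?eqxx ?(ltn_trans jx) //= ltn_eqF // nth_rcons jx Hx.
move=> jz; rewrite index_eq ?(leq_trans jz) // (inj_eq val_inj) (negPf zx) /=.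
by rewrite Hz.
Qed.

Record state_inv n D C N (E : edge_set n) (phi : coloring n (D + C)) (s : store) : Prop :=
  StateInv {
    inv_small : small N s;
    inv_n : reg s 0 = n;
    inv_D : reg s 1 = D;
    inv_C : reg s 2 = C;
    inv_phi : stores_phi s phi;
    inv_proper : proper phi;
    inv_dom : forall e, (phi e != None) = (e \in E);
    inv_simple : simple E;
    inv_nbrs : exists nb, stores_nbrs (arr s 2) (arr s 3) nb /\
      forall x, uniq (nb x) /\ forall w, (w \in nb x) = adj E x w;
    inv_unvisited : forall w : 'I_n, arr s 4 w = 0 }.

(** * Correctness and running time of the phases of an insertion *)

Section Insertion.
Variables (n D C alpha N : nat).
Variables (E : edge_set n) (phi : coloring n (D + C)) (u v : 'I_n) (nb : 'I_n -> seq 'I_n).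
Hypotheses (sE : simple E) (aE : arboricity E <= alpha) (dE : forall x, degree E x <= D).
Hypothesis alphaC : 2 * alpha <= C.
Hypothesis pE : forall e, (phi e != None) = (e \in E :\ [set u; v]).
Hypotheses (uv : u != v) (uvE : [set u; v] \in E) (pp : proper phi).
Hypothesis nbE : forall x, uniq (nb x) /\ forall w, (w \in nb x) = adj (E :\ [set u; v]) x w.
Hypotheses (nN : n.+1 < N) (qN : (D + C).+1 < N).

Let N1 : 1 < N. Proof. by apply: leq_ltn_trans nN. Qed.

Let ord_lt (x : 'I_n) : x.+1 < N.
Proof. by have := ltn_ord x; clear -nN; lia. Qed.

Definition params (s : store) : Prop :=
  [/\ reg s 0 = n, reg s 2 = C, reg s 4 = u, reg s 5 = v & reg s 6 = (D + C).+1].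

Definition graph_data s : Prop :=
  stores_phi s phi /\ stores_nbrs (arr s 2) (arr s 3) nb.

Lemma frame_params c s s' : frame c s s' ->
  all (fun x => ~~ writes_reg c x) [:: 0; 2; 4; 5; 6] -> params s -> params s'.
Proof. by case=> H _ /and5P[/H h0 /H h2 /H h4 /H h5 /andP[/H h6 _]]; rewrite /params h0 h2 h4 h5 h6. Qed.

Lemma frame_graph_data c s s' : frame c s s' ->
  all (fun a => ~~ writes_arr c a) [:: 0; 1; 2; 3] -> graph_data s -> graph_data s'.
Proof.
case=> _ H /and5P[/H h0 /H h1 /H h2 /H h3 _] [H1 H2]; split; last by rewrite h2 h3.
exact: stores_phi_eq H1.
Qed.

Definition stores_queue s (Q : seq 'I_n) (p : 'I_n -> 'I_n) : Prop :=
  [/\ reg s 8 = size Q, forall j, j < size Q -> arr s 5 j = nth u Q j &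
      forall w : 'I_n, arr s 4 w = if w \in u :: Q then (p w).+1 else 0].

Lemma size_nb x : size (nb x) <= degree E x.
Proof.
have [un mn] := nbE x; rewrite degree_adj // -(card_uniqP un).
by apply: subset_leq_card; apply/subsetP => w; rewrite mn inE => /setD1P[].
Qed.

Lemma nb_color x w : w \in nb x -> exists c, phi [set x; w] = Some c.
Proof.
have [_ ->] := nbE x; rewrite /adj -pE.
by case: (phi _) => // c; exists c.
Qed.

Lemma is_candE s (a g : 'I_n) (c : 'I_(D + C)) ec :
  params s -> graph_data s -> reg s 11 = a -> reg s 12 = code (phi [set g; a]) ->
  eval s ec = c.+1 -> (eval s (is_cand ec) != 0) = cand phi g a c.
Proof.
move=> [r0 r2 r4 r5 r6] [[HM HT] _] ea epc eec.
rewrite /= eec ea r6 HT epc /cand /code.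
case: (free _ _ _) => //=; case: (phi _) => [c0|] //=.
rewrite (inj_eq (@Some_inj _)) -(inj_eq val_inj) eqSS [in RHS]eq_sym /=.
by case: (nat_of_ord c == c0).
Qed.

Lemma visit_correct s0 (b : 'I_n) Q p :
  small N s0 -> params s0 -> graph_data s0 -> uniq (u :: Q) ->
  stores_queue s0 Q p -> b \in Q -> (forall w, w \in u :: Q -> p w \in u :: Q) ->
  reg s0 10 = b -> reg s0 11 = p b -> reg s0 12 = code (phi [set p (p b); p b]) ->
  reg s0 13 = 0 -> reg s0 14 = 0 ->
  let l := [seq w <- nb b | (w \in targets phi p b) && (w \notin u :: Q)] in
  hoare N visit s0 (scost visit * (size (nb b)).+1) (fun s =>
    reg s 13 = #|targets phi p b| /\
    stores_queue s (Q ++ l) (fun w => if w \in u :: Q then p w else b)).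
Proof.
move=> ss0 pa0 gd0 uQ sq0 bQ pcl rb ra rpc rx rj l.
have [un mn] := nbE b; pose p' (w : 'I_n) := if w \in u :: Q then p w else b.
rewrite -/p'.
pose vis i := [seq w <- take i (nb b) | (w \in targets phi p b) && (w \notin u :: Q)].
pose I k s := exists i, [/\ i + k = size (nb b), reg s 14 = i,
  reg s 13 = count (mem (targets phi p b)) (take i (nb b)) & stores_queue s (Q ++ vis i) p'].
have unQ i : i <= size (nb b) -> uniq (u :: Q ++ vis i).
  move=> _; rewrite -cat_cons cat_uniq uQ /= filter_uniq ?take_uniq // andbT.
  by apply/hasPn => w; rewrite mem_filter => /andP[/andP[]].
apply: (@hoare_for N N1 _ _ _ _ I) => //.
  exists 0; rewrite add0n rj rx take0 /vis /= take0 /= cats0; split=> //.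
  have [q1 q2 q3] := sq0; split=> // w; rewrite q3 /p'; by case: (w \in _).
move=> s k ss fr [i [ik ri rxi sqi]].
have pa : params s by apply: (frame_params fr).
have gd : graph_data s by apply: (frame_graph_data fr).
have e10 : reg s 10 = b by rewrite (proj1 fr).
have e11 : reg s 11 = p b by rewrite (proj1 fr).
have e12 : reg s 12 = code (phi [set p (p b); p b]) by rewrite (proj1 fr).
have [[HM HT] HN] := gd; have [Hsz Hn] := HN b.
rewrite [eval _ _]/= ri e10 Hsz; case: ltnP => /= inb; last first.
  have il : i = size (nb b) by clear -ik inb; lia.
  move: rxi sqi; rewrite il /vis take_size => -> sq; split=> //.
  rewrite -size_filter -(card_uniqP (filter_uniq _ un)); apply: eq_card => w.
  rewrite mem_filter /=; case: (boolP (w \in targets _ _ _)) => //=.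
  rewrite inE => H; rewrite mn; move: H; rewrite /candw /adj -pE.
  by case: (phi _).
split; first by clear -ik inb; lia.
set w := nth b (nb b) i; have wnb : w \in nb b by apply: mem_nth.
have [c pc] := nb_color wnb.
have [r0 r2 r4 r5 r6] := pa.
have ew : arr s 2 (b * n + i) = w by apply: Hn.
have ec : arr s 0 (b * n + w) = c.+1 by rewrite HM pc.
have tk : take i.+1 (nb b) = rcons (take i (nb b)) w by rewrite (take_nth b inb).
have cN : c.+1 < N by apply: leq_ltn_trans (ltn_ord c) (ltnW qN).
have cnt : count (mem (targets phi p b)) (take i.+1 (nb b)) < N.
  apply: leq_ltn_trans (count_size _ _) _; rewrite size_takel //.
  by apply: leq_ltn_trans inb _; have := uniq_size_ord un; clear -nN; lia.
have iN : i.+1 < N by have := uniq_size_ord un; clear -inb nN; lia.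
rewrite r0 e10 ri ew; split; first by apply: ltnW; apply: ord_lt.
rewrite ec; split=> //.
set s1 := set_reg (set_reg s 15 w) 16 c.+1.
have candE : (eval s1 (is_cand (Reg 16)) != 0) = (w \in targets phi p b).
  by rewrite (@is_candE s1 (p b) (p (p b)) c) // inE /candw pc.
(* Neighbor lists have no repetition, so [w] was not queued earlier in this visit. *)
have wQ : (w \in u :: Q ++ vis i) = (w \in u :: Q).
  rewrite -cat_cons mem_cat mem_filter; case: (_ \in u :: Q) => //=.
  rewrite andbC; suff /negPf-> : w \notin take i (nb b) by [].
  by have := take_uniq i.+1 un; rewrite tk rcons_uniq => /andP[].
have visS : vis i.+1 = if (w \in targets phi p b) && (w \notin u :: Q) then rcons (vis i) w else vis i.
  by rewrite /vis tk filter_rcons.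
have cntS : count (mem (targets phi p b)) (take i.+1 (nb b)) =
    reg s 13 + (w \in targets phi p b).
  by rewrite tk -cats1 count_cat -rxi /= addn0.
rewrite -[X in if X then _ else _]/(eval s1 (is_cand (Reg 16)) != 0) candE.
have [q1 q2 q3] := sqi.
have fin s' : reg s' 14 = i.+1 -> reg s' 13 = reg s 13 + (w \in targets phi p b) ->
    stores_queue s' (Q ++ vis i.+1) p' -> exists2 k', k' < k & I k' s'.
  move=> h1 h2 h3; exists k.-1; first by clear -ik inb; lia.
  exists i.+1; split=> //; first by clear -ik inb; lia.
  by rewrite cntS.
case: (boolP (w \in targets _ _ _)) => wt; last first.
  split; first by rewrite addn1.
  apply: fin; rewrite /= ?ri ?addn1 ?(negPf wt) ?addn0 //.
  by rewrite visS (negPf wt).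
split; first by rewrite /=; move: cnt; rewrite cntS wt.
rewrite /= q3 wQ; case: (boolP (w \in u :: Q)) => wv /=.
  split; first by rewrite addn1.
  apply: fin; rewrite /= ?addn1 ?wt ?addn1 //.
  by rewrite visS wv andbF.
have wvis : w \notin u :: Q ++ vis i by rewrite wQ.
have szv : (size (Q ++ vis i)).+1 < n.
  by have := @uniq_size_ord _ (w :: u :: Q ++ vis i); rewrite /= wvis => H; apply: H; apply: unQ; apply: ltnW.
rewrite q1; split; first by rewrite addn1.
split; first by apply: ltnW; apply: ord_lt.
split; first by rewrite addn1; apply: leq_trans szv _; apply: ltnW; apply: ltnW.
split; first by rewrite addn1.
apply: fin; rewrite /= ?addn1 ?wt ?addn1 //.
rewrite visS wt wv /= -cats1 catA; split=> /=.
- by rewrite [RHS]size_cat addn1.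
- move=> j; rewrite [X in _ < X]size_cat addn1 ltnS nth_cat => jl.
  case: (ltngtP j (size (Q ++ vis i))) => [jl1|jl1|->]; first by rewrite q2.
    by clear -jl jl1; lia.
  by rewrite subnn.
- move=> x; rewrite val_eqE; rewrite -(cat_cons u (Q ++ vis i)) mem_cat mem_seq1.
  case: (eqVneq x w) => [->|xw]; first by rewrite orbT /p' (negPf wv).
  by rewrite q3 orbF.
Qed.

(** The last visit queues targets of [b] before their number is known. The memory therefore holds an
    extension [Q'], [p'], needed for the cleanup, of the search state [Q], [p] that the argument is
    about. *)
Definition search_done s : Prop :=
  exists Q p d h Q' p', [/\ search_inv phi u v Q p d h,
    #|targets phi p (nth u Q h)| <= C,
    [/\ reg s 10 = nth u Q h, reg s 11 = p (nth u Q h) &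
        reg s 12 = code (phi [set p (p (nth u Q h)); p (nth u Q h)])],
    [/\ stores_queue s Q' p', uniq (u :: Q') &
        forall w, w \in Q' -> 0 < degree E w] &
    forall w, w \in u :: Q -> w \in u :: Q' /\ p' w = p w].

(** Time per unit of degree. A reached vertex has positive degree, so [degree E b + 1] is at most
    twice [degree E b]; hence the factor 2. *)
Definition search_rate : nat :=
  (cost (Eqb (Reg 9) (Cst 0))).+1 + (scost dequeue + scost visit * 2 + scost decide).

Lemma code_lt (o : option 'I_(D + C)) : code o < N.
Proof.
by case: o => [c|] /=; [apply: leq_ltn_trans (ltn_ord c) (ltnW qN)|apply: ltnW N1].
Qed.

Lemma search_step_correct s Q p d h : small N s -> params s -> graph_data s ->
  search_inv phi u v Q p d h -> reg s 7 = h -> reg s 9 = 0 -> stores_queue s Q p ->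
  hoare N search_body s
    (scost dequeue + (scost visit * (size (nb (nth u Q h))).+1 + scost decide))
    (fun s' => (reg s' 9 = 1 /\ search_done s') \/
      (exists Q' p' d', [/\ reg s' 9 = 0, reg s' 7 = h.+1,
        search_inv phi u v Q' p' d' h.+1, stores_queue s' Q' p' &
        take h.+1 Q' = rcons (take h Q) (nth u Q h)])).
Proof.
move=> ss pa gd I r7 r9 sq; set b := nth u Q h.
have hQ : h < size Q by apply: (search_continues sE aE alphaC pE I).
have bQ : b \in Q by apply: mem_nth.
have [r0 r2 r4 r5 r6] := pa; have [[HM HT] HN] := gd; have [q1 q2 q3] := sq.
have pcl := si_p_closed I; have bu : b \in u :: Q by rewrite inE bQ orbT.
have oN (x : 'I_n) : x < N by apply: ltnW; apply: ord_lt.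
have hn : h.+1 < N.
  by have /= := uniq_size_ord (si_uniq I); clear -hQ nN; lia.
apply: (@hoare_seq N _ _ _ _ _ (fun s' =>
  [/\ [/\ reg s' 10 = b, reg s' 11 = p b & reg s' 12 = code (phi [set p (p b); p b])],
      reg s' 13 = 0, reg s' 14 = 0 & stores_queue s' Q p])).
  apply: wp_hoare => //; rewrite /= r7 q2 // q3 bu subn1 /= q3 (pcl b bu) subn1 /= r0 HM.
  do 5![split; first by [apply: oN | apply: code_lt | apply: ltnW N1]].
  by [].
move=> s1 ss1 fr1 [[r10 r11 r12] r13 r14 sq1].
have pa1 : params s1 by apply: (frame_params fr1).
have gd1 : graph_data s1 by apply: (frame_graph_data fr1).
apply: hoare_seq (visit_correct ss1 pa1 gd1 (si_uniq I) sq1 bQ pcl r10 r11 r12 r13 r14) _.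
set l := [seq w <- nb b | _]; set p' := fun w => if _ then _ else _.
move=> s2 ss2 fr2 [r13' sq2].
have [r0' r2' r4' r5' r6'] : params s2 by apply: (frame_params fr2).
have ul : uniq l by apply: filter_uniq; have [] := nbE b.
have lE w : (w \in l) = (w \in targets phi p b) && (w \notin u :: Q).
  rewrite mem_filter; case: (boolP (w \in targets _ _ _)) => //= wt.
  rewrite andbC; have [_ ->] := nbE b.
  by move: wt; rewrite inE /candw /adj -pE; case: (phi _).
apply: wp_hoare => //; rewrite /= r13' r2'.
have f7 : reg s2 7 = h by rewrite (proj1 fr2) // (proj1 fr1).
have f9 : reg s2 9 = 0 by rewrite (proj1 fr2) // (proj1 fr1).
have e10 : reg s2 10 = b by rewrite (proj1 fr2).
have e11 : reg s2 11 = p b by rewrite (proj1 fr2).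
have e12 : reg s2 12 = code (phi [set p (p b); p b]) by rewrite (proj1 fr2).
rewrite addn1 ltnS; case: (leqP #|targets phi p b| C) => /= cb.
  split; first exact: N1.
  left; split=> //; exists Q, p, d, h, (Q ++ l), p'; split=> //.
  - split=> //; last first.
      move=> w; rewrite mem_cat => /orP[/(si_degree sE pE uvE I)//|].
      rewrite lE => /andP[+ _]; rewrite inE => /(candw_adj pE) aw.
      by rewrite degree_adj // card_gt0; apply/set0Pn; exists b; rewrite inE adjC.
    rewrite -cat_cons cat_uniq (si_uniq I) ul andbT /=.
    by apply/hasPn => w; rewrite lE => /andP[].
  - by move=> w wQ; split; [rewrite -cat_cons mem_cat wQ | rewrite /p' wQ].
rewrite f7 addn1; split=> //; right.
have I' := search_step sE aE alphaC pE uv uvE I cb ul lE.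
exists (Q ++ l), p'; eexists; split=> //; first exact: I'.
by rewrite takel_cat // (take_nth u hQ).
Qed.

(** The time still available is proportional to the sum of the degrees of the vertices not yet
    expanded, initially [2 * #|E|], plus one final test. *)
Lemma search_correct s0 : small N s0 -> params s0 -> graph_data s0 ->
  reg s0 7 = 0 -> reg s0 9 = 0 -> stores_queue s0 [:: v] (fun=> u) ->
  hoare N search s0 (search_rate * (2 * #|E|) + (cost (Eqb (Reg 9) (Cst 0))).+1) search_done.
Proof.
move=> ss0 pa0 gd0 r7 r9 sq0; set kex := (cost _).+1.
pose J k s := (exists Q p d h, [/\ search_inv phi u v Q p d h, reg s 7 = h, reg s 9 = 0,
    stores_queue s Q p & k = search_rate * (\sum_(x | x \notin take h Q) degree E x) + kex])
  \/ [/\ reg s 9 = 1, search_done s & k = kex].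
apply: (@hoare_while N N1 _ _ _ _ J) => //.
- left; exists [:: v], (fun=> u), (fun w => if w == u then 0 else 1), 0.
  split=> //; first exact: search_init.
  by rewrite -(sum_degree sE).
- move=> s k ss fr [[Q [p [d [h [_ _ r9' _ _]]]]]|[_ sd ->] _ //].
  by rewrite /= r9'.
move=> s k ss fr [[Q [p [d [h [I r7' r9' sq kE]]]]]|[r9' _ _]]; last by rewrite /= r9'.
move=> _; have pa : params s by apply: (frame_params fr).
have gd : graph_data s by apply: (frame_graph_data fr).
have := search_step_correct ss pa gd I r7' r9' sq; set B := _ + _ => H.
exists B.
have hQ : h < size Q by apply: (search_continues sE aE alphaC pE I).
set b := nth u Q h in B H *.
have bQ : b \in Q by apply: mem_nth.
have bh : b \notin take h Q.
  have := si_uniq I; rewrite /= => /andP[_]; rewrite -{1}(cat_take_drop h Q) cat_uniq.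
  case/and3P => _ /hasPn H1 _; apply: H1.
  by rewrite (drop_nth u hQ) mem_head.
have eB : kex + B <= search_rate * degree E b.
  have d1 := si_degree sE pE uvE I bQ.
  have szb : size (nb b) <= degree E b by apply: size_nb.
  rewrite /search_rate -/kex /B.
  move: (degree E b) (size _) (scost _) (scost _) (scost _) kex d1 szb {kE H B J}.
  by move=> *; nia.
apply: hoare_weaken H (leqnn _) _ => s' _ _ [[r9s sd]|].
  exists kex; split; first by right.
  rewrite kE (@sum_nat_split _ (fun x => x \notin take h Q) _ b bh) mulnDr -addSn.
  by rewrite -/kex leq_add2r (leq_trans eB) ?leq_addr.
case=> Q' [p' [d' [r9s r7s I' sq' tk]]].
exists (search_rate * (\sum_(x | x \notin take h.+1 Q') degree E x) + kex); split.
  by left; exists Q', p', d', h.+1.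
rewrite kE (@sum_nat_split _ (fun x => x \notin take h Q) _ b bh) mulnDr tk.
rewrite (eq_bigl (fun y => (y \notin take h Q) && (y != b))); last first.
  by move=> y; rewrite mem_rcons inE negb_or andbC.
by rewrite -addSn -/kex addnA leq_add2r leq_add2r.
Qed.

(** Every color below the least suitable one is used at [a] or at [b]. At most [#|E|] colors are
    used at a vertex, so the scan makes at most [2 * #|E|] steps whatever the size of the
    palette. *)
Lemma scan_correct s0 (b a g : 'I_n) :
  small N s0 -> params s0 -> graph_data s0 ->
  reg s0 10 = b -> reg s0 11 = a -> reg s0 12 = code (phi [set g; a]) -> reg s0 16 = 1 ->
  (exists c, cand phi g a c && free phi b c) ->
  hoare N scan s0 (scost scan * (2 * #|E|).+1)
    (fun s => exists c : 'I_(D + C), [/\ reg s 16 = c.+1, cand phi g a c & free phi b c]).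
Proof.
move=> ss0 pa0 gd0 r10 r11 r12 r16 [c0 g0].
pose P0 (c : 'I_(D + C)) := cand phi g a c && free phi b c.
case: (@arg_minnP _ c0 P0 (fun c => c) g0) => cs gs smin.
have cs2 : cs <= 2 * #|E|.
  have H x : #|[set c | ~~ free phi x c]| <= #|E|.
    by apply: card_free => e; rewrite pE => /setD1P[].
  rewrite mul2n -addnn; apply: leq_trans (leq_add (H a) (H b)).
  apply: leq_trans (leq_card_setU _ _).
  have {1}-> : (cs : nat) = \sum_(c < D + C | c < cs) 1.
    by rewrite -(big_ord_widen _ (fun=> 1)) ?sum_nat_const ?card_ord ?muln1 // ltnW.
  rewrite sum1_card; apply: subset_leq_card; apply/subsetP => c; rewrite !inE => ccs.
  rewrite -negb_and; apply: contraL ccs => /andP[fa fb]; rewrite -leqNgt.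
  by apply: smin; rewrite /P0 /cand fa.
pose I k s := exists c : 'I_(D + C), [/\ reg s 16 = c.+1, c <= cs & k = cs - c].
have cs0 : 0 < D + C by apply: leq_ltn_trans (ltn_ord cs).
apply: (@hoare_weaken _ _ _ (scost scan * (cs : nat).+1) _
   (fun s => exists c : 'I_(D + C), [/\ reg s 16 = c.+1, cand phi g a c & free phi b c])) => //.
  apply: (@hoare_for N N1 _ _ _ _ I) => //.
    by exists (Ordinal cs0); rewrite subn0.
  move=> s k ss fr [c [rc ccs kE]].
  have pa : params s by apply: (frame_params fr).
  have gd : graph_data s by apply: (frame_graph_data fr).
  have e10 : reg s 10 = b by rewrite (proj1 fr).
  have e11 : reg s 11 = a by rewrite (proj1 fr).
  have e12 : reg s 12 = code (phi [set g; a]) by rewrite (proj1 fr).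
  have := @is_candE s a g c (Reg 16) pa gd e11 e12 rc.
  have [r0 r2 r4 r5 r6] := pa; have [[HM HT] HN] := gd.
  set ic := is_cand _ => icE.
  rewrite [eval _ _]/= -[X in _ + (X == 0)]/(eval s ic) e10 r6 rc HT.
  rewrite -[eval s ic == 0]negbK icE addn_eq0 !eqb0 negbK.
  have step : ~~ P0 c -> 0 < k /\ wp N (incr 16) s (fun s' => exists2 k', k' < k & I k' s').
    move=> gc; have ck : c < cs.
      rewrite ltn_neqAle ccs andbT; apply: contraNneq gc => H.
      by rewrite (val_inj H : c = cs).
    have cq : c.+1 < D + C by apply: leq_ltn_trans (ltn_ord cs).
    split; first by rewrite kE subn_gt0.
    rewrite /= rc; split; first by rewrite addn1; apply: leq_ltn_trans cq (ltnW qN).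
    exists (cs - c.+1); first by rewrite kE; clear -ck; lia.
    by exists (Ordinal cq); rewrite /= addn1.
  move: step; rewrite /P0.
  case: (boolP (free phi b c)) => fb; case: (boolP (cand phi g a c)) => ca /= step.
  - by exists c.
  - exact: step.
  - exact: step.
  - exact: step.
by rewrite leq_mul2l ltnS cs2 orbT.
Qed.

Lemma link_correct s0 (p : 'I_n -> 'I_n) (t : seq 'I_n) (b : 'I_n) :
  small N s0 -> params s0 -> reg s0 18 = b -> last u t = b ->
  (forall z, z \in t -> arr s0 4 z = (p z).+1) ->
  path (fun y z => p z == y) u t -> uniq (u :: t) ->
  hoare N link s0 (scost link * (size t).+1)
    (fun s => path (fun y z : 'I_n => arr s 6 y == z) u t).
Proof.
move=> ss0 pa0 r18 lb par pt ut.
pose I k s := exists t1 t2, [/\ t = t1 ++ t2, k = size t1, reg s 18 = last u t1 &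
  path (fun y z : 'I_n => arr s 6 y == z) (last u t1) t2].
apply: (@hoare_for N N1 _ _ _ _ I) => //.
  by exists t, [::]; rewrite cats0 lb.
move=> s k ss fr [t1 [t2 [tE kE rs pt2]]].
have [r0 r2 r4 r5 r6] : params s by apply: (frame_params fr).
rewrite [eval _ _]/= rs r4; case/lastP: t1 => [|t1 z] in tE kE rs pt2 *.
  by rewrite eqxx /= tE.
rewrite last_rcons in rs pt2 *.
have zt : z \in t by rewrite tE mem_cat mem_rcons mem_head.
have zu : z != u.
  by case/andP: ut => un _; apply: contraNneq un => <-.
have py : p z = last u t1.
  by move: pt; rewrite tE cat_path rcons_path => /andP[/andP[_ /eqP]].
rewrite (inj_eq val_inj) (negPf zu) /=; split; first by rewrite kE size_rcons.
have oN (x : 'I_n) : x < N by apply: ltnW; apply: ord_lt.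
have a4 : arr s 4 z = (p z).+1 by rewrite (proj2 fr) // par.
rewrite rs a4 subn1 /=; do 3![split; first exact: oN].
exists (size t1); first by rewrite kE size_rcons.
exists t1, (z :: t2); rewrite -cat_rcons py /= eqxx; split=> //.
(* The cell of [y] is overwritten, but [y] does not occur in [z :: t2], so the links set before
   survive. *)
rewrite /= eqxx /=; set y := last u t1.
have yn : y \notin z :: t2.
  move: ut; rewrite tE cat_rcons -cat_cons cat_uniq => /and3P[_ /hasPn H _].
  by apply/negP => /H; rewrite /= mem_last.
apply: (sub_in_path (P := fun x => x != y)) pt2.
  by move=> x x' xy _ /=; rewrite (inj_eq val_inj) (negPf xy).
by apply/allP => x xz; apply: contraNneq yn => <-.
Qed.

(** Invariant: augmenting the current coloring along the remaining path gives the same result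
    throughout. The final color is laid after the loop, hence the [recolor] in the conclusion. *)
Lemma shift_loop_correct s0 psi0 (a b : 'I_n) rest c :
  small N s0 -> params s0 -> stores_phi s0 psi0 ->
  reg s0 17 = a -> reg s0 18 = b -> reg s0 10 = last b rest ->
  path (fun y z : 'I_n => arr s0 6 y == z) b rest ->
  proper psi0 -> psi0 [set a; b] = None -> uniq (a :: b :: rest) ->
  good psi0 a b rest c ->
  hoare N shift_loop s0 (scost shift_loop * (size rest).+1)
    (fun s => exists (a' b' : 'I_n) (psi : coloring n (D + C)),
      [/\ reg s 17 = a', reg s 18 = b', stores_phi s psi, psi [set a'; b'] = None &
          recolor psi [set a'; b'] (Some c) = augment psi0 a b rest c]).
Proof.
move=> ss0 pa0 sp0 r17 r18 r10 prest pp0 pab0 u0 g0.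
pose I k s := exists (a1 b1 : 'I_n) (r : seq 'I_n) (psi : coloring n (D + C)),
  [/\ [/\ reg s 17 = a1, reg s 18 = b1, reg s 10 = last b1 r & k = size r],
      stores_phi s psi /\ path (fun y z : 'I_n => arr s 6 y == z) b1 r,
      proper psi /\ psi [set a1; b1] = None,
      uniq (a1 :: b1 :: r) /\ good psi a1 b1 r c &
      augment psi a1 b1 r c = augment psi0 a b rest c].
apply: (@hoare_for N N1 _ _ _ _ I) => //; first by exists a, b, rest, psi0.
move=> s k ss fr [a1 [b1 [r [psi [[s17 s18 s10 kE] [sp pr] [pp1 pab1] [u1 g1] au1]]]]].
have pa : params s by apply: (frame_params fr).
have [r0 r2 r4 r5 r6] := pa.
rewrite [eval _ _]/= s18 s10 (inj_eq val_inj); case: r => [|w r] in s10 kE pr u1 g1 au1 *.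
  by rewrite eqxx /=; exists a1, b1, psi.
have b1l : b1 != last w r.
  by case/and3P: u1 => _ + _; apply: contraNneq => ->; apply: mem_last.
case: ifP => [|_]; first by rewrite /= (negPf b1l).
split; first by rewrite kE.
rewrite /shift_body.
case/andP: pr => /eqP ew pr.
have [c' pbw [fa gd]] : exists2 c', psi [set b1; w] = Some c' &
    free psi a1 c' /\ good (shift psi a1 b1 w) b1 w r c.
  by move: g1 => /=; case: (psi _) => [c'|] //= /andP[fa gd]; exists c'.
have oN (x : 'I_n) : x < N by apply: ltnW; apply: ord_lt.
have [wa wb] : w != a1 /\ w != b1.
  move: u1; rewrite /= !inE !negb_or => /andP[/and3P[_ h1 _] /andP[/andP[h2 _] _]].
  by rewrite ![w == _]eq_sym.
have ec : arr s 0 (b1 * n + w) = c'.+1 by have [-> _] := sp; rewrite pbw.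
apply: wp_seq; apply: (wp_set_reg (k := w)); [by rewrite /= s18 | exact: oN | cbv beta].
apply: wp_seq; apply: (wp_set_reg (k := c'.+1)); last cbv beta.
- by rewrite /= s18 r0.
- by apply: leq_ltn_trans (ltn_ord c') (ltnW qN).
have nN' : n <= N := ltnW (ltnW nN).
apply: wp_seq; apply: (wp_uncolor_edge _ _ _ _ _ _ _ _ pp1 pbw) => //.
move=> s1 reg1 arr1 sp1.
have pab2 : recolor psi [set b1; w] None [set a1; b1] = None.
  by rewrite ffunE pab1; case: ifP.
apply: wp_seq; apply: (wp_color_edge _ _ _ _ _ _ _ sp1 pab2 (c := c')); rewrite ?reg1 //.
move=> s2 reg2 arr2; rewrite -pbw -shiftE // => sp2.
rewrite /= !reg2 ?reg1 /= ?s18; do 2![split; first exact: oN].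
exists (size r); first by rewrite kE.
exists b1, w, r, (shift psi a1 b1 w); split=> //=.
- split=> //; rewrite ?reg2 ?reg1 /= //.
- by split=> //; rewrite arr2 // arr1.
- by split; [apply: proper_shift pbw fa|apply: shift_none].
- by split=> //; case/andP: u1.
Qed.

(** The root is marked without being queued, so its entry is reset separately afterwards. *)
Lemma cleanup_correct s0 Q p :
  small N s0 -> params s0 -> stores_queue s0 Q p -> uniq (u :: Q) -> reg s0 14 = 0 ->
  hoare N cleanup s0 (scost cleanup * (size Q).+1)
    (fun s => forall w : 'I_n, w != u -> arr s 4 w = 0).
Proof.
move=> ss0 pa0 [q1 q2 q3] uQ r14.
pose I k s := reg s 14 + k = size Q /\
  forall w : 'I_n, w != u -> w \notin drop (reg s 14) Q -> arr s 4 w = 0.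
apply: (@hoare_for N N1 _ _ _ _ I) => //.
  rewrite /I r14; split=> // w wu; rewrite drop0 => wQ.
  by rewrite q3 inE (negPf wu) (negPf wQ).
move=> s k ss fr [ik H].
have e8 : reg s 8 = size Q by rewrite (proj1 fr).
rewrite [eval _ _]/= e8; case: ltnP => /= iQ; last first.
  by move=> w wu; apply: H => //; rewrite drop_oversize.
have q2' : arr s 5 (reg s 14) = nth u Q (reg s 14) by rewrite (proj2 fr) // q2.
have Qn := uniq_size_ord uQ.
split; first by clear -ik iQ; lia.
split; first by apply: ltnW.
split; first by move: Qn; rewrite /=; clear -iQ nN; lia.
exists k.-1; first by clear -ik iQ; lia.
split; first by rewrite /=; clear -ik iQ; lia.
move=> w wu /=; rewrite addn1 q2' (inj_eq val_inj) => wd.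
case: eqP => // /eqP wn; apply: H => //.
by rewrite (drop_nth u iQ) inE negb_or wn.
Qed.

(** The new edge makes [m] positive, so constants are absorbed and [(2 * m).+1] is at most
    [3 * m]. *)
Lemma insert_rate_bound a b k c d e f g h i j l m : 0 < m ->
  a + (b * (2 * m) + k + (c + (d * (2 * m).+1 + (e + (f * (2 * m).+1 + (g +
    (h * (2 * m).+1 + (i + (j * (2 * m).+1 + l))))))))) <=
  (a + (b * 2 + k) + c + d * 3 + e + f * 3 + g + h * 3 + i + j * 3 + l) * m.
Proof.
move=> m0; have H x : x <= x * m by apply: leq_pmulr.
have := (H a, H k, H c, H d, H e, H f); have := (H g, H h, H i, H j, H l).
move=> [[[[? ?] ?] ?] ?] [[[[[? ?] ?] ?] ?] ?]; lia.
Qed.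

Definition insert_rate : nat :=
  scost search_start + (search_rate * 2 + (cost (Eqb (Reg 9) (Cst 0))).+1) +
  scost (SetReg 16 (Cst 1)) + scost scan * 3 + scost (SetReg 18 (Reg 10)) +
  scost link * 3 + scost (Seq (SetReg 17 (Reg 4)) (SetReg 18 (Reg 5))) +
  scost shift_loop * 3 + scost (Seq (color_edge 17 18 16) (SetReg 14 (Cst 0))) +
  scost cleanup * 3 +
  scost (Seq (SetCell 4 (Reg 4) (Cst 0)) (Seq (add_nbr 4 5) (add_nbr 5 4))).

Lemma nbE_push x :
  uniq (push_nbr (push_nbr nb u v) v u x) /\
  forall w, (w \in push_nbr (push_nbr nb u v) v u x) = adj E x w.
Proof.
have E_adj y z : adj E y z = adj (E :\ [set u; v]) y z || ([set y; z] == [set u; v]).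
  by rewrite /adj !inE; case: eqVneq => [->|]; rewrite ?uvE ?orbF.
have vu : (v == u) = false by rewrite eq_sym (negPf uv).
have nuv : v \notin nb u by have [_ ->] := nbE u; rewrite /adj !inE eqxx.
have nvu : u \notin nb v by have [_ ->] := nbE v; rewrite /adj !inE setUC eqxx.
have [un mn] := nbE x; rewrite /push_nbr vu.
case: (eqVneq x v) => [xv|xv]; last case: (eqVneq x u) => [xu|xu].
- have [uv1 mv] := nbE v; rewrite rcons_uniq nvu uv1; split=> // w.
  by rewrite mem_rcons inE mv E_adj xv edge_eq eqxx vu /= orbC.
- have [uu1 mu] := nbE u; rewrite rcons_uniq nuv uu1; split=> // w.
  by rewrite mem_rcons inE mu E_adj xu edge_eq eqxx (negPf uv) /= orbF orbC.
- by split=> // w; rewrite mn E_adj edge_eq (negPf xu) (negPf xv) orbF.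
Qed.

Lemma insertion_correct s0 :
  small N s0 -> reg s0 0 = n -> reg s0 1 = D -> reg s0 2 = C -> reg s0 4 = u -> reg s0 5 = v ->
  graph_data s0 -> (forall w : 'I_n, arr s0 4 w = 0) ->
  hoare N insertion s0 (insert_rate * #|E|) (fun s => exists psi : coloring n (D + C),
    [/\ state_inv N E psi s, shift_augment phi [set u; v] psi &
        exists2 r, recourse phi psi <= r & C.+1 ^ r <= (2 * alpha) ^ r * n]).
Proof.
move=> ss0 r0 r1 r2 r4 r5 gd0 a40.
set Post := fun s => _; set m := #|E|.
have m0 : 0 < m by apply/card_gt0P; exists [set u; v].
have oN (x : 'I_n) : x < N by apply: ltnW; apply: ord_lt.
have nN' : n <= N := ltnW (ltnW nN).
apply: (@hoare_weaken _ _ _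
  (scost search_start + (search_rate * (2 * m) + (cost (Eqb (Reg 9) (Cst 0))).+1 +
  (scost (SetReg 16 (Cst 1)) + (scost scan * (2 * m).+1 + (scost (SetReg 18 (Reg 10)) +
  (scost link * (2 * m).+1 + (scost (Seq (SetReg 17 (Reg 4)) (SetReg 18 (Reg 5))) +
  (scost shift_loop * (2 * m).+1 + (scost (Seq (color_edge 17 18 16) (SetReg 14 (Cst 0))) +
  (scost cleanup * (2 * m).+1 +
  scost (Seq (SetCell 4 (Reg 4) (Cst 0)) (Seq (add_nbr 4 5) (add_nbr 5 4)))))))))))))
  _ Post) => //; last first.
  exact: insert_rate_bound.
apply: (hoare_seq (R := fun s => [/\ params s, reg s 7 = 0, reg s 9 = 0 &
    stores_queue s [:: v] (fun=> u)])).
  apply: wp_hoare => //; rewrite /= r1 r2 r4 r5 !addn1.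
  split=> //; do 3![split; first by [apply: ord_lt | apply: oN]].
  split; first exact: ltnW N1.
  split; first exact: N1.
  split; first exact: ltnW N1.
  split=> //; split=> //= [[|//]|w] //.
  rewrite !inE !(inj_eq val_inj); case: (w == v); rewrite ?orbT //= orbF.
  by case: (w == u).
move=> s1 ss1 fr1 [pa1 r7 r9 sq1].
have gd1 : graph_data s1 by apply: (frame_graph_data fr1).
apply: hoare_seq (search_correct ss1 pa1 gd1 r7 r9 sq1) _.
move=> s2 ss2 fr2 [Q [p [d [h [Q' [p' [I tb [e10 e11 e12] [sq2 uQ' dQ'] QQ']]]]]]].
have pa2 : params s2 by apply: (frame_params fr2).
have gd2 : graph_data s2 by apply: (frame_graph_data fr2).
have hQ : h < size Q by apply: (search_continues sE aE alphaC pE I).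
have depth := search_depth sE aE alphaC pE uv uvE I.
have excol := search_color sE aE dE alphaC pE uvE I tb.
set b := nth u Q h in tb e10 e11 e12 depth excol.
have bQ : b \in Q by apply: mem_nth.
have [rest [szr ur lr pr [rQ chr]]] := search_path sE aE alphaC pE uv uvE I bQ.
have uQ'2 : uniq Q' by case/andP: uQ'.
have sQ' : size Q' <= 2 * m by apply: size_non_isolated.
have vrQ : {subset v :: rest <= Q}.
  by move=> x; rewrite inE => /orP[/eqP->|/rQ //]; apply: (si_v I).
have sr : size (v :: rest) <= 2 * m.
  apply: size_non_isolated => //; first by case/andP: ur.
  by move=> x /vrQ; apply: (si_degree sE pE uvE I).
have [q1 q2 q3] := sq2.
have par z : z \in v :: rest -> arr s2 4 z = (p z).+1.
  by move=> /vrQ zQ; have [|zQ' <-] := QQ' z; rewrite ?inE ?zQ ?orbT // q3 zQ'.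
apply: (hoare_seq (R := fun s => reg s 16 = 1)); first by apply: wp_hoare.
move=> s3 ss3 fr3 e16.
have pa3 : params s3 by apply: (frame_params fr3).
have gd3 : graph_data s3 by apply: (frame_graph_data fr3).
rewrite -(proj1 fr3) // in e10; rewrite -(proj1 fr3) // in e11.
rewrite -(proj1 fr3) // in e12.
apply: hoare_seq (scan_correct ss3 pa3 gd3 e10 e11 e12 e16 excol) _.
move=> s4 ss4 fr4 [c [e16' cc fc]].
have pa4 : params s4 by apply: (frame_params fr4).
rewrite -(proj1 fr4) // in e10.
apply: (hoare_seq (R := fun s => reg s 18 = b)).
  by apply: wp_hoare => //; rewrite /= e10.
move=> s5 ss5 fr5 e18.
have pa5 : params s5 by apply: (frame_params fr5).
have gd5 : graph_data s5.
  by apply: (frame_graph_data fr5) => //; apply: (frame_graph_data fr4).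
apply: (hoare_seq (R := fun s => path (fun y z : 'I_n => arr s 6 y == z) u (v :: rest))).
  apply: hoare_weaken (link_correct (p := p) (t := v :: rest) ss5 pa5 e18 _ _ _ ur) _ _ => //.
  - by move=> z /par; rewrite (proj2 fr5) // (proj2 fr4) // (proj2 fr3).
  - by rewrite /= (si_pv I) eqxx.
  - by rewrite leq_mul2l ltnS sr orbT.
move=> s6 ss6 fr6 /= /andP[_ next].
have pa6 : params s6 by apply: (frame_params fr6).
have gd6 : graph_data s6 by apply: (frame_graph_data fr6).
have [_ _ e4 e5 _] := pa6.
apply: (hoare_seq (R := fun s => reg s 17 = u /\ reg s 18 = v)).
  by apply: wp_hoare => //; rewrite /= e4 e5.
move=> s7 ss7 fr7 [e17 e18'].
have pa7 : params s7 by apply: (frame_params fr7).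
have [sp7 HN7] : graph_data s7 by apply: (frame_graph_data fr7).
have phu : phi [set u; u] = None by apply: (phi_loop sE pE).
have phv : phi [set u; v] = None by apply: (phi_uv pE).
have gg : good phi u v rest c := chain_good pp phv phu ur (chr c cc fc).
have e10' : reg s7 10 = last v rest.
  by rewrite (proj1 fr7) // (proj1 fr6) // (proj1 fr5) // e10 lr.
have next7 : path (fun y z : 'I_n => arr s7 6 y == z) v rest by rewrite (proj2 fr7).
have [sa ppsi dom _] := augmentP pp phv uv ur gg.
have rec := recourse_augment pp phv uv ur gg.
set psi := augment phi u v rest c in sa ppsi dom rec.
apply: (hoare_seq (R := fun s => exists (a' b' : 'I_n) (psi' : coloring n (D + C)),
      [/\ reg s 17 = a', reg s 18 = b', stores_phi s psi', psi' [set a'; b'] = None &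
          recolor psi' [set a'; b'] (Some c) = psi])).
  apply: hoare_weaken (shift_loop_correct ss7 pa7 sp7 e17 e18' e10' next7 pp phv ur gg) _ _ => //.
  by rewrite leq_mul2l ltnS (leq_trans _ sr) ?orbT //= leqnSn.
move=> s8 ss8 fr8 [a' [b' [psi' [e17' e18'' sp8 pab' psiE]]]].
have pa8 : params s8 by apply: (frame_params fr8).
have [e80 e82 e84 e85 e86] := pa8.
have e16'' : reg s8 16 = c.+1.
  by rewrite (proj1 fr8) // (proj1 fr7) // (proj1 fr6) // (proj1 fr5).
apply: (hoare_seq (R := fun s => stores_phi s psi /\ reg s 14 = 0)).
  apply: wp_hoare => //; apply: wp_seq.
  apply: (wp_color_edge nN' qN e80 e86 e17' e18'' e16'' sp8 pab') => s' rs' as' sp'.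
  split; first exact: ltnW N1.
  by rewrite -psiE.
move=> s9 ss9 fr9 [sp9 e14].
have pa9 : params s9 by apply: (frame_params fr9).
have sq9 : stores_queue s9 Q' p'.
  have frA a : a \in [:: 4; 5] -> arr s9 a = arr s2 a.
    rewrite !inE => /orP[] /eqP->; by rewrite (proj2 fr9) // (proj2 fr8) //
      (proj2 fr7) // (proj2 fr6) // (proj2 fr5) // (proj2 fr4) // (proj2 fr3).
  rewrite /stores_queue !frA // (proj1 fr9) // (proj1 fr8) // (proj1 fr7) // (proj1 fr6) //.
  by rewrite (proj1 fr5) // (proj1 fr4) // (proj1 fr3).
apply: (hoare_seq (R := fun s => forall w : 'I_n, w != u -> arr s 4 w = 0)).
  apply: hoare_weaken (cleanup_correct ss9 pa9 sq9 uQ' e14) _ _ => //.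
  by rewrite leq_mul2l ltnS sQ' orbT.
move=> s10 ss10 fr10 unv.
have [e100 e102 e104 e105 e106] : params s10 by apply: (frame_params fr10).
have sp10 : stores_phi s10 psi by apply: stores_phi_eq sp9; apply: (proj2 fr10).
have HN10 : stores_nbrs (arr s10 2) (arr s10 3) nb.
  rewrite (proj2 fr10) // (proj2 fr9) // (proj2 fr8) // (proj2 fr10 3) //.
  by rewrite (proj2 fr9 3) // (proj2 fr8 3).
have e101 : reg s10 1 = D.
  rewrite (proj1 fr10) // (proj1 fr9) // (proj1 fr8) // (proj1 fr7) // (proj1 fr6) //.
  by rewrite (proj1 fr5) // (proj1 fr4) // (proj1 fr3) // (proj1 fr2) // (proj1 fr1).
have vu : (v == u) = false by rewrite eq_sym (negPf uv).
have nuv : v \notin nb u by have [_ ->] := nbE u; rewrite /adj !inE eqxx.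
have nvu : u \notin nb v by have [_ ->] := nbE v; rewrite /adj !inE setUC eqxx.
have ubn z : uniq (nb z) by have [] := nbE z.
have ubn1 z : uniq (push_nbr nb u v z).
  by rewrite /push_nbr; case: eqP => // _; rewrite rcons_uniq nuv ubn.
apply: (hoare_weaken (B := scost (Seq (SetCell 4 (Reg 4) (Cst 0)) (Seq (add_nbr 4 5) (add_nbr 5 4))))
  (Q := fun s => [/\ reg s = reg s10, stores_phi s psi,
    stores_nbrs (arr s 2) (arr s 3) (push_nbr (push_nbr nb u v) v u) &
    forall w : 'I_n, arr s 4 w = 0])) => //; last first.
  move=> s ss fr [rs sp HN un4]; exists psi; split=> //; last first.
    (* The path has [(d b).-1] edges besides [uv], which is the exponent in [search_depth]. *)
    by exists (d b).-1 => //; rewrite -szr.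
  split=> //; rewrite ?rs //.
  - by move=> e; rewrite dom pE !inE; case: (eqVneq e [set u; v]) => [->|_].
  - by exists (push_nbr (push_nbr nb u v) v u); split=> // x; apply: nbE_push.
apply: wp_hoare => //; apply: wp_seq; split; first exact: ltnW N1.
set s11 := set_cell _ _ _ _.
apply: wp_seq; apply: (wp_add_nbr (x := u) (y := v) (nb := nb)) => //; first exact: ltnW nN.
move=> s' rs' as' HN'.
apply: (wp_add_nbr (x := v) (y := u) (nb := push_nbr nb u v)); rewrite ?rs' //; first exact: ltnW nN.
  by rewrite /push_nbr vu.
move=> s'' rs'' as'' HN''; split=> //.
- by apply: (@stores_phi_eq _ _ s10); rewrite // as'' // as'.
- move=> w; rewrite as'' // as' //= e104 (inj_eq val_inj); case: eqP => // /eqP wu.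
  exact: unv.
Qed.

End Insertion.

(** * Deletions *)

(** A deletion rebuilds the neighbor lists of both endpoints from their rows of the color matrix.
    This takes time linear in [n], which is allowed because the time bound concerns insertions. *)
Definition rescan_body (r : nat) : cmd :=
  Seq (If (Cell 0 (mat (Reg r) (Reg 14)))
        (Seq (SetCell 2 (mat (Reg r) (Cell 3 (Reg r))) (Reg 14))
             (SetCell 3 (Reg r) (Add (Cell 3 (Reg r)) (Cst 1))))
        Skip)
      (incr 14).

Definition rescan (r : nat) : cmd :=
  Seq (Seq (SetCell 3 (Reg r) (Cst 0)) (SetReg 14 (Cst 0)))
      (While (Ltb (Reg 14) (Reg 0)) (rescan_body r)).

Definition rescan_time (r n : nat) : nat :=
  scost (Seq (SetCell 3 (Reg r) (Cst 0)) (SetReg 14 (Cst 0))) +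
  scost (While (Ltb (Reg 14) (Reg 0)) (rescan_body r)) * n.+1.

Definition deletion : cmd :=
  Seq (Seq (SetReg 6 (Add (Add (Reg 1) (Reg 2)) (Cst 1)))
      (Seq (SetReg 16 (Cell 0 (mat (Reg 4) (Reg 5)))) (uncolor_edge 4 5 16)))
  (Seq (rescan 4) (rescan 5)).

Section Deletion.
Variables (n q N : nat).
Hypotheses (nN : n.+1 < N) (qN : q.+1 < N).

Definition reset_nbrs (phi : coloring n q) (nb : 'I_n -> seq 'I_n) (x z : 'I_n) :=
  if z == x then [seq w <- enum 'I_n | phi [set x; w] != None] else nb z.

Lemma rescan_correct s0 r (x : 'I_n) (phi : coloring n q) nb :
  wf_cmd (rescan_body r) -> r != 14 ->
  small N s0 -> reg s0 0 = n -> reg s0 r = x -> stores_colors (arr s0 0) phi ->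
  stores_nbrs (arr s0 2) (arr s0 3) nb -> (forall z, uniq (nb z)) ->
  hoare N (rescan r) s0 (rescan_time r n) (fun s =>
    stores_nbrs (arr s 2) (arr s 3) (reset_nbrs phi nb x)).
Proof.
move=> wf r14 ss0 r0 rx HM HN un.
have N1 : 1 < N by apply: leq_ltn_trans nN.
have oN (y : 'I_n) : y.+1 < N by have := ltn_ord y; clear -nN; lia.
have r14' : (r == 14) = false := negbTE r14.
pose nbs i z := if z == x then [seq w <- take i (enum 'I_n) | phi [set x; w] != None] else nb z.
have unbs i z : uniq (nbs i z).
  by rewrite /nbs; case: ifP => // _; rewrite filter_uniq // take_uniq // enum_uniq.
apply: (hoare_seq (R := fun s => reg s 14 = 0 /\
    stores_nbrs (arr s 2) (arr s 3) (nbs 0))).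
  apply: wp_hoare => //; rewrite /= rx.
  do 2![split; first exact: ltnW N1].
  split=> // z; have [sz Hz] := HN z; rewrite /nbs take0 (inj_eq val_inj).
  by case: eqP.
move=> s1 ss1 fr1 [e14 HN1].
pose I k s := [/\ reg s 14 + k = n & stores_nbrs (arr s 2) (arr s 3) (nbs (reg s 14))].
apply: (@hoare_for N N1 _ _ _ n I) => //.
  by rewrite /I e14.
move=> s k ss fr [ik HNs].
have e0 : reg s 0 = n by rewrite (proj1 fr) ?(proj1 fr1) //= orbF.
have er : reg s r = x by rewrite (proj1 fr) ?(proj1 fr1) //= ?orbF ?r14'.
have HMs : stores_colors (arr s 0) phi by rewrite (proj2 fr) // (proj2 fr1).
rewrite [eval _ _]/= e0; case: ltnP => /= iN; last first.
  move=> z; have := HNs z; rewrite /nbs /reset_nbrs take_oversize //.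
  by rewrite size_enum_ord.
split; first by clear -ik iN; lia.
set w := Ordinal iN.
have tk : take (reg s 14).+1 (enum 'I_n) = rcons (take (reg s 14) (enum 'I_n)) w.
  rewrite (take_nth w) ?size_enum_ord //; congr rcons.
  by apply: val_inj; rewrite /= nth_enum_ord.
have [sx Hx] := HNs x.
have iS : reg s 14 + 1 < N by rewrite addn1; apply: (oN w).
have nbsS : nbs (reg s 14).+1 x =
    if phi [set x; w] != None then rcons (nbs (reg s 14) x) w else nbs (reg s 14) x.
  by rewrite /nbs eqxx tk filter_rcons.
have nbsS' z : z != x -> nbs (reg s 14).+1 z = nbs (reg s 14) z.
  by rewrite /nbs => /negPf->.
rewrite er e0 -[arr s 0 _]/(arr s 0 (x * n + w)) HMs.
have codeE : (code (phi [set x; w]) != 0) = (phi [set x; w] != None).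
  by case: (phi _).
rewrite codeE; case: ifP nbsS => pw nbsS; last first.
  split=> //; exists k.-1; first by clear -ik iN; lia.
  split; first by rewrite /=; clear -ik iN; lia.
  move=> z /=; rewrite addn1; case: (eqVneq z x) => [->|zx]; first by rewrite nbsS.
  by rewrite nbsS'.
have szx : (size (nbs (reg s 14) x)).+1 <= n.
  by have := uniq_size_ord (unbs (reg s 14).+1 x); rewrite nbsS size_rcons.
rewrite sx !addn1; split; first by apply: ltnW; apply: (oN w).
split; first by apply: leq_ltn_trans szx (ltnW nN).
split; first by rewrite -addn1.
exists k.-1; first by clear -ik iN; lia.
split; first by rewrite /=; clear -ik iN; lia.
move=> z /=; have [sz Hz] := HNs z; have uz := uniq_size_ord (unbs (reg s 14) z).
rewrite (inj_eq val_inj); case: (eqVneq z x) => [->|zx]; last first.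
  rewrite nbsS' //; split=> // j jz.
  rewrite index_eq ?(leq_trans jz) // (inj_eq val_inj) (negPf zx) /=.
  by rewrite Hz.
rewrite nbsS size_rcons; split=> // j; rewrite ltnS leq_eqVlt => /orP[/eqP->|jx].
  by rewrite eqxx nth_rcons ltnn eqxx.
by rewrite index_eq ?eqxx ?(ltn_trans jx) //= ltn_eqF // nth_rcons jx Hx.
Qed.

End Deletion.

Lemma deletion_correct n D C N (E : edge_set n) (phi : coloring n (D + C)) s0 (u v : 'I_n) :
  n.+1 < N -> (D + C).+1 < N -> state_inv N E phi s0 ->
  reg s0 4 = u -> reg s0 5 = v -> [set u; v] \in E ->
  exists B, hoare N deletion s0 B (fun s =>
    state_inv N (E :\ [set u; v]) (recolor phi [set u; v] None) s).
Proof.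
move=> nN qN I r4 r5 uvE.
have N1 : 1 < N by apply: leq_ltn_trans nN.
have nN' : n <= N := ltnW (ltnW nN).
have [ss0 r0 r1 r2 sp pp dom sE [nb [HN nbE]] unv] := I.
have oN (y : 'I_n) : y < N by have := ltn_ord y; clear -nN; lia.
have [c pc] : exists c, phi [set u; v] = Some c.
  by move: (dom [set u; v]); rewrite uvE; case: (phi _) => // c _; exists c.
set psi := recolor phi [set u; v] None.
have un z : uniq (nb z) by have [] := nbE z.
set c0 := Seq (SetReg 6 (Add (Add (Reg 1) (Reg 2)) (Cst 1)))
      (Seq (SetReg 16 (Cell 0 (mat (Reg 4) (Reg 5)))) (uncolor_edge 4 5 16)).
have H0 : hoare N c0 s0 (scost c0) (fun s => stores_phi s psi).
  apply: wp_hoare => //.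
  apply: wp_seq; apply: (wp_set_reg (k := (D + C).+1)) => //.
    by rewrite /= r1 r2 addn1.
  apply: wp_seq; apply: (wp_set_reg (k := c.+1)).
  - by rewrite /= r0 r4 r5; case: sp => -> _; rewrite pc.
  - by apply: leq_ltn_trans (ltn_ord c) (ltnW qN).
  by apply: (wp_uncolor_edge nN' qN _ _ _ _ _ _ pp pc).
pose nb1 := reset_nbrs psi nb u.
have un1 z : uniq (nb1 z).
  by rewrite /nb1 /reset_nbrs; case: ifP => // _; rewrite filter_uniq ?enum_uniq.
exists (scost c0 + (rescan_time 4 n + rescan_time 5 n)).
apply: hoare_seq H0 _ => s1 ss1 fr1 sp1.
have [HM1 HT1] := sp1.
apply: (hoare_seq (R := fun s => stores_nbrs (arr s 2) (arr s 3) nb1)).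
  apply: (@rescan_correct _ _ _ nN s1 4 u psi nb) => //.
  - by rewrite (proj1 fr1).
  - by rewrite (proj1 fr1).
  - by rewrite (proj2 fr1) // (proj2 fr1).
move=> s2 ss2 fr2 HN2.
have HM2 : stores_colors (arr s2 0) psi by rewrite (proj2 fr2).
apply: hoare_weaken (@rescan_correct _ _ _ nN s2 5 v psi nb1 _ _ ss2 _ _ HM2 HN2 un1) _ _ => //.
- by rewrite (proj1 fr2) // (proj1 fr1).
- by rewrite (proj1 fr2) // (proj1 fr1).
move=> s3 ss3 fr3 HN3.
have dom' e : (psi e != None) = (e \in E :\ [set u; v]).
  by rewrite ffunE !inE -dom; case: (eqVneq e [set u; v]).
split=> //.
- by rewrite (proj1 fr3) // (proj1 fr2) // (proj1 fr1).
- by rewrite (proj1 fr3) // (proj1 fr2) // (proj1 fr1).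
- by rewrite (proj1 fr3) // (proj1 fr2) // (proj1 fr1).
- by apply: stores_phi_eq sp1; rewrite (proj2 fr3) // (proj2 fr2).
- exact: proper_uncolor.
- by move=> e /setD1P[_ /sE].
- exists (reset_nbrs psi nb1 v); split=> // x.
  have adjE y w : (psi [set y; w] != None) = adj (E :\ [set u; v]) y w by rewrite dom'.
  rewrite /nb1 /reset_nbrs; case: (eqVneq x v) => [->|xv].
    rewrite filter_uniq ?enum_uniq //; split=> // w.
    by rewrite mem_filter mem_enum andbT adjE.
  case: (eqVneq x u) => [->|xu].
    rewrite filter_uniq ?enum_uniq //; split=> // w.
    by rewrite mem_filter mem_enum andbT adjE.
  have [ux mx] := nbE x; split=> // w; rewrite mx /adj !inE edge_eq.
  by rewrite (negPf xu) (negPf xv).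
- by move=> w; rewrite (proj2 fr3) // (proj2 fr2) // (proj2 fr1).
Qed.

(** * The algorithm *)

Definition coloring_algorithm : algorithm := Algorithm insertion deletion.

Section Maintain.
Variables (n D C alpha : nat).
Hypothesis alphaC : 2 * alpha <= C.

(** The base of [word_bound], whose exponent 4 is the degree allowed by [wf_expr]. *)
Let N := n + D + C + 2.
Let nN : n.+1 < N. Proof. by rewrite /N; lia. Qed.
Let qN : (D + C).+1 < N. Proof. by rewrite /N; lia. Qed.

(** Integer form of the logarithmic bound, common to both halves of the theorem; [r'] is the number
    of shifts. *)
Definition recourse_bound (r : nat) : Prop :=
  exists2 r', r <= r' & C.+1 ^ r' <= (2 * alpha) ^ r' * n.

Lemma state_inv_init :
  @state_inv n D C N set0 [ffun=> None : option 'I_(D + C)] (init_store n D C alpha).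
Proof.
have N0 : 0 < N by rewrite /N; lia.
split=> //=.
(* The parameter [alpha] is below [N] because [2 * alpha <= C]. *)
- split=> //= -[|[|[|[|x]]]] /=; rewrite ?nth_nil //; rewrite /N; lia.
- split=> [x y|x c]; rewrite ?ffunE //=.
  by case: freeP => // H; case: H => e _; rewrite ffunE.
- by move=> e f _; rewrite ffunE.
- by move=> e; rewrite ffunE inE.
- by move=> e; rewrite inE.
- exists (fun=> [::]); split=> [x|x]; first by split.
  by split=> // w; rewrite /adj !inE.
Qed.

Lemma state_inv_feed (E : edge_set n) (phi : coloring n (D + C)) s (up : update n) :
  state_inv N E phi s -> state_inv N E phi (feed up s).
Proof.
case=> ss r0 r1 r2 sp pp dom sE nbs un.
have oN (x : 'I_n) : x < N by have := ltn_ord x; rewrite /N; lia.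
by case: up => x y; split=> //; do 2!apply: small_set_reg => //.
Qed.

Lemma update_correct (E : edge_set n) (phi : coloring n (D + C)) s (up : update n) :
  state_inv N E phi s -> admissible D alpha E up ->
  exists t s' (psi : coloring n (D + C)),
    [/\ exec (N ^ 4) (feed up s) (handler coloring_algorithm up) t s',
        state_inv N (apply_update E up) psi s' &
        match up with
        | Insert u v =>
            [/\ t <= insert_rate * #|apply_update E up|, recourse_bound (recourse phi psi) &
                shift_augment phi [set u; v] psi]
        | Delete u v => psi = recolor phi [set u; v] None
        end].
Proof.
move=> I; have If := state_inv_feed up I.
case: up If => u v If [/= app [dE aE]]; last first.
  have [B [t [s' [ex _ ss' I']]]] := deletion_correct nN qN If erefl erefl app.
  by exists t, s', (recolor phi [set u; v] None).
have [uv uvE] := andP app.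
have [ss r0 r1 r2 sp pp dom sE [nb [HN nbE]] un] := If.
have E'E : ([set u; v] |: E) :\ [set u; v] = E by rewrite setU1K.
have sE' : simple ([set u; v] |: E).
  by move=> e; rewrite !inE => /orP[/eqP->|/sE //]; exists u, v.
have [t [s' [ex tB ss' [psi [I' sa rb]]]]] :
    hoare N insertion (feed (Insert u v) s) (insert_rate * #|[set u; v] |: E|)
      (fun s => exists psi : coloring n (D + C),
    [/\ state_inv N ([set u; v] |: E) psi s, shift_augment phi [set u; v] psi &
        exists2 r, recourse phi psi <= r & C.+1 ^ r <= (2 * alpha) ^ r * n]).
  apply: (@insertion_correct n D C alpha N _ phi u v nb) => //.
  - by move=> e; rewrite E'E.
  - by rewrite !inE eqxx.
  - by move=> x; rewrite E'E.
by exists t, s', psi.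
Qed.

Lemma run_state_inv (E : edge_set n) s : run coloring_algorithm 4 D C alpha E s ->
  exists phi : coloring n (D + C), state_inv N E phi s.
Proof.
elim=> [|{}E {}s up t s' _ [phi I] adm ex]; first by eexists; apply: state_inv_init.
have [t' [s'' [psi [ex' I' _]]]] := update_correct I adm.
by have [_ ->] := exec_det ex ex'; exists psi.
Qed.

Lemma algorithm_correct :
  maintains_coloring coloring_algorithm 4 insert_rate n D C alpha recourse_bound.
Proof.
have stE (E : edge_set n) (phi : coloring n (D + C)) s : state_inv N E phi s -> stores s phi.
  by move=> I u v; have [HM _] := inv_phi I; rewrite HM.
have ecE (E : edge_set n) (phi : coloring n (D + C)) s : state_inv N E phi s -> edge_coloring E phi.
  by case.
move=> E s /run_state_inv[phi I]; exists phi; split; [exact: stE I|exact: ecE I|].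
move=> up /(update_correct I)[t [s' [psi [ex I' H]]]].
by exists t, s', psi; split=> //; [exact: stE I'|exact: ecE I'].
Qed.

End Maintain.

Lemma maintains_coloring_mono A b k n D C alpha (P Q : nat -> Prop) :
  (forall r, P r -> Q r) -> maintains_coloring A b k n D C alpha P ->
  maintains_coloring A b k n D C alpha Q.
Proof.
move=> PQ H E s /H[phi [st ec Hup]]; exists phi; split=> // up /Hup[t [s' [psi [h1 h2 h3 h4]]]].
exists t, s', psi; split=> //; case: up h1 h3 h4 => // u v _ _ [h5 h6 h7].
by split=> //; apply: PQ.
Qed.

(** * From the integer inequality to logarithms *)

Import Order.TTheory GRing.Theory Num.Theory.
Local Open Scope ring_scope.

(** Since [C + 1] is at least [(2 + eps) * alpha], the integer inequality becomes
    [(1 + eps / 2) ^+ r' <= n]. Taking logarithms with [ln (1 + x) >= x / (1 + x)] at [x = eps / 2]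
    gives the factor [(2 + eps) / eps]. *)
Lemma recourse_bound_ln (R : realType) (n C alpha r : nat) (eps : R) : 0 < eps ->
  (2 + eps) * alpha%:R - 1 <= C%:R -> recourse_bound n C alpha r ->
  r%:R <= (2 + eps) * (eps^-1 * ln n%:R).
Proof.
move=> e0 eC [r' rr' H].
have n0 : (0 < n)%N.
  by rewrite lt0n; apply: contraTneq H => ->; rewrite muln0 -ltnNge expn_gt0.
have ln0 : 0 <= ln (n%:R : R) by rewrite ln_ge0 // ler1n.
have einv : 0 < eps^-1 by rewrite invr_gt0.
apply: (@le_trans _ _ r'%:R); first by rewrite ler_nat.
case: r' H {rr'} => [_|r' H].
  by rewrite !mulr_ge0 // ?addr_ge0 // ltW.
(* With a positive exponent, [alpha = 0] would make the right-hand side of [H] vanish. *)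
have a0 : (0 < alpha)%N.
  by rewrite lt0n; apply: contraTneq H => ->; rewrite muln0 exp0n // mul0n -ltnNge expn_gt0.
move: r'.+1 H => {}r' H.
have a0R : 0 < alpha%:R :> R by rewrite ltr0n.
have key : (1 + eps / 2) ^+ r' <= n%:R.
  have : ((2 + eps) * alpha%:R) ^+ r' <= (2 * alpha%:R) ^+ r' * n%:R :> R.
    apply: (@le_trans _ _ ((C.+1)%:R ^+ r')).
      have e2 : 0 <= 2 + eps by rewrite addr_ge0 // ltW.
      apply: lerXn2r; rewrite ?nnegrE ?mulr_ge0 ?ler0n //.
      by move: eC; rewrite lerBlDr natr1.
    by rewrite -natrM -!natrX -natrM ler_nat.
  have -> : (2 + eps) * alpha%:R = (2 * alpha%:R) * (1 + eps / 2) by field.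
  by rewrite exprMn ler_pM2l // exprn_gt0 // mulr_gt0.
have x0 : 0 < 1 + eps / 2 by rewrite addr_gt0 // divr_gt0.
have lnle : r'%:R * ln (1 + eps / 2) <= ln n%:R.
  rewrite mulr_natl -lnXn //; rewrite ler_ln // ?posrE ?ltr0n //; exact: exprn_gt0.
(* This is [ln (1 + y) <= y] at [y = (1 + eps / 2)^-1 - 1], with signs reversed. *)
have lnge : eps / (2 + eps) <= ln (1 + eps / 2).
  have x1 : 0 < (1 + eps / 2)^-1 by rewrite invr_gt0.
  have := le_ln1Dx (x := (1 + eps / 2)^-1 - 1).
  rewrite addrCA subrr addr0 lnV ?posrE // ltrBrDr addNr => /(_ x1).
  rewrite lerNl; apply: le_trans; rewrite opprB.
  rewrite le_eqVlt; apply/orP; left; apply/eqP; field.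
  by rewrite lt0r_neq0 // addr_gt0.
have : r'%:R * (eps / (2 + eps)) <= ln n%:R.
  by apply: le_trans lnle; rewrite ler_wpM2l.
have e2 : 0 < 2 + eps by rewrite addr_gt0.
have -> : r'%:R * (eps / (2 + eps)) = r'%:R / ((2 + eps) * eps^-1).
  by field; rewrite !lt0r_neq0.
by rewrite ler_pdivrMr ?mulr_gt0 // mulrC mulrA.
Qed.

Theorem mainTheorem2 (R : realType) :
  exists (A : algorithm) (b k : nat),
    (forall eps0 : R, 0 < eps0 ->
     exists K : R,
     forall (n Delta C alpha : nat) (eps : R),
       0 < eps -> eps <= eps0 ->
       (2 + eps) * alpha%:R - 1 <= C%:R ->
       maintains_coloring A b k n Delta C alpha
         (fun r : nat => r%:R <= K * (eps^-1 * ln n%:R)))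
    /\
    (exists K : R,
     forall n Delta alpha : nat,
       maintains_coloring A b k n Delta (2 * alpha)%N alpha
         (fun r : nat => r%:R <= K * (alpha%:R * ln n%:R))).
Proof.
exists coloring_algorithm, 4%N, insert_rate; split.
  (* The factor [2 + eps] of [recourse_bound_ln] is uniformly bounded once [eps <= eps0]. *)
  move=> eps0 e00; exists (2 + eps0) => n Delta C alpha eps e0 ee0 eC.
  have alphaC : (2 * alpha <= C)%N.
    rewrite -ltnS -(ltr_nat R) natrM -[C.+1%:R]natr1.
    case: alpha eC => [|alpha] eC; first by rewrite mulr0 ltr_wpDl.
    move: eC; rewrite lerBlDr; apply: lt_le_trans.
    by rewrite ltr_pM2r ?ltr0n // ltrDl.
  apply: (@maintains_coloring_mono _ _ _ _ _ _ _ _ _ _ (@algorithm_correct _ _ _ _ alphaC)) => r rb.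
  apply: le_trans (recourse_bound_ln e0 eC rb) _.
  have [r' _ H] := rb.
  have n0 : (0 < n)%N.
    by rewrite lt0n; apply: contraTneq H => ->; rewrite muln0 -ltnNge expn_gt0.
  rewrite ler_wpM2r ?lerD2l // mulr_ge0 ?invr_ge0 ?(ltW e0) //.
  by rewrite ln_ge0 // ler1n.
(* For [eps = 1 / alpha] one has [(2 + eps) * alpha - 1 = 2 * alpha], and [2 + eps] is at most 3. *)
exists 3 => n Delta alpha.
apply: (@maintains_coloring_mono _ _ _ _ _ _ _ _ _ _ (@algorithm_correct _ _ _ _ (leqnn _))) => r rb.
case: alpha rb => [|alpha] rb.
  (* For [alpha = 0] this [eps] is meaningless, but the integer inequality forces [r' = 0], so
     nothing is recolored. *)
  have [r' rr' H] := rb; rewrite mul0r mulr0.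
  case: r' rr' H => [|r']; first by rewrite leqn0 => /eqP->.
  by rewrite muln0 exp1n exp0n.
have a0 : 0 < alpha.+1%:R :> R by rewrite ltr0n.
have [r' _ H] := rb.
have n0 : (0 < n)%N.
  by rewrite lt0n; apply: contraTneq H => ->; rewrite muln0 -ltnNge expn_gt0.
have := @recourse_bound_ln R n (2 * alpha.+1) alpha.+1 r alpha.+1%:R^-1.
rewrite invr_gt0 a0 invrK => /(_ isT) H1.
apply: le_trans (H1 _ rb) _.
  by rewrite mulrDl mulVf ?lt0r_neq0 // addrK natrM.
rewrite ler_wpM2r //; first by rewrite mulr_ge0 ?(ltW a0) // ln_ge0 // ler1n.
have -> : 3 = 2 + 1 :> R by ring.
by rewrite lerD2l invf_le1 // ler1n.
Qed.
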